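(* Let $K/k$ be a finite separable field extension with normal closure $\tilde{K}/k$, and set $G=\mathrm{Gal}(\tilde{K}/k)$ and $G'=\mathrm{Gal}(\tilde{K}/K)$. Assume that $K/k$ is an almost classically Galois extension such that $G$ is the holomorph of a characteristically simple group $N$; that is, $N$ is a characteristically simple normal subgroup of $G$ which is a normal complement of $G'$ in $G$, so that $G=N\rtimes_{\varphi}G'$, and the conjugation action $\varphi:G'\to\mathrm{Aut}(N)$ is an isomorphism. Then $\tilde{K}[N]^{G}$ defines a minimal Hopf-Galois structure on $K/k$.
   Context: Hopf-Galois structures. A finite field extension $K/k$ has a Hopf-Galois structure if there is a finite-dimensional cocommutative $k$-Hopf algebra $H$ and a Hopf action $\mu:H\to\mathrm{End}_k(K)$ such that the map $(1,\mu):K\otimes_k H\to\mathrm{End}_k(K)$, $(1,\mu)(s\otimes h)(t)=s\cdot(\mu(h)(t))$, is an isomorphism. Minimality. A Hopf-Galois structure given by a $k$-Hopf algebra $H$ is called minimal if $H$ has exactly two $k$-sub-Hopf algebras (namely $k$ and $H$); the trivial case $\dim_k(H)=1$ is excluded. Greither-Pareigis correspondence. Let $K/k$ be finite separable, with $\tilde K$, $G$, $G'$ as in the claim. Let $\lambda:G\to\mathrm{Perm}(G/G')$, $\lambda_g(xG')=gxG'$, be the faithful left translation action on the set of left cosets; $G$ is identified with $\lambda(G)$. A subgroup $N$ of $\mathrm{Perm}(G/G')$ is regular if it acts transitively on $G/G'$ with trivial point stabilizers. By the Greither-Pareigis theorem, the Hopf-Galois structures on $K/k$ are in one-to-one correspondence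 with the regular subgroups $N$ of $\mathrm{Perm}(G/G')$ normalized by $G$. The structure corresponding to $N$ is the one defined by the $k$-Hopf algebra $\tilde{K}[N]^{G}=\{x\in\tilde{K}[N]\mid\sigma(x)=x\text{ for all }\sigma\in G\}$, where $\sigma\left(\sum_{\tau\in N}a_\tau\tau\right)=\sum_{\tau\in N}\sigma(a_\tau)\,\lambda(\sigma)\tau\lambda(\sigma)^{-1}$. Almost classically Galois extensions. A normal complement of $G'$ in $G$ is a normal subgroup $N$ of $G$ with $N\cap G'=\{1\}$ and $NG'=G$. The extension $K/k$ is almost classically Galois if $G'$ has a normal complement in $G$. Such an $N$, viewed inside $\mathrm{Perm}(G/G')$ via $\lambda$, is a regular subgroup normalized by $G$, and hence defines a Hopf-Galois structure $\tilde K[N]^G$ on $K/k$. The holomorph of a group $N$ is $\mathrm{Hol}(N)=N\rtimes\mathrm{Aut}(N)$. A group is characteristically simple if it is nontrivial and has no proper nontrivial characteristic subgroup. *)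

(* Defs.v *)
From HB Require Import structures.
From mathcomp Require Import all_boot all_order all_algebra.
From mathcomp Require Import all_fingroup all_solvable all_field.

Set Implicit Arguments.
Unset Strict Implicit.
Unset Printing Implicit Defensive.

Import GRing.Theory VectorInternalTheory.
Local Open Scope ring_scope.

Reserved Notation "v ⊗ w" (at level 40, left associativity).

(* Model of the tensor product of finite-dimensional vector spaces: matrices  *)
(* of coordinates over the products of basis vectors. Its universal property  *)
(* is tlift_tprod / tprod_ext below.                                          *)

Definition tens (k : fieldType) (V W : vectType k) : Type :=
  'M[k]_(dim V, dim W).

HB.instance Definition _ (k : fieldType) (V W : vectType k) :=
  Vector.copy (tens V W) 'M[k]_(dim V, dim W).

Section Tensor.
Variable k : fieldType.
Implicit Types U V W : vectType k.

Definition tprod V W (v : V) (w : W) : tens V W := (v2r v)^T *m v2r w.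

Local Notation "v ⊗ w" := (tprod v w).

Definition basisv V (i : 'I_(dim V)) : V := r2v (delta_mx 0 i).

(* The linear map V ⊗ W -> U induced by b, meaningful for a bilinear b.       *)
Definition tlift V W U (b : V -> W -> U) (t : tens V W) : U :=
  \sum_i \sum_j (t : 'M_(_, _)) i j *: b (basisv i) (basisv j).

Definition tmap V W V' W' (f : V -> V') (g : W -> W') : tens V W -> tens V' W' :=
  tlift (fun v w => f v ⊗ g w).

Definition tassoc U V W : tens (tens U V) W -> tens U (tens V W) :=
  tlift (fun s w => tlift (fun u v => u ⊗ (v ⊗ w)) s).

Definition tswap V W : tens V W -> tens W V := tlift (fun v w => w ⊗ v).

(* The image of A ⊗ B in V ⊗ W, for subspaces A of V and B of W.              *)
Definition tensv V W (A : {vspace V}) (B : {vspace W}) : {vspace tens V W} :=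
  <<[seq a ⊗ b | a <- vbasis A, b <- vbasis B]>>%VS.

Lemma basisvE V (v : V) : v = \sum_i v2r v 0 i *: basisv i.
Proof.
apply: (can_inj (@v2rK _ _)); rewrite linear_sum {1}[v2r v]row_sum_delta.
by apply: eq_bigr => i _; rewrite linearZ /= /basisv r2vK.
Qed.

Lemma tlift_is_linear V W U (b : V -> W -> U) : linear (tlift b).
Proof.
move=> a s t; rewrite /tlift scaler_sumr -big_split; apply: eq_bigr => i _.
rewrite scaler_sumr -big_split; apply: eq_bigr => j _.
by rewrite !mxE scalerDl scalerA.
Qed.

HB.instance Definition _ V W U (b : V -> W -> U) :=
  GRing.isLinear.Build k (tens V W) U *:%R (tlift b) (tlift_is_linear b).

Lemma tlift_tprod V W U (b : V -> W -> U) v w :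
    (forall v, linear (b v)) -> (forall w, linear (b^~ w)) ->
  tlift b (v ⊗ w) = b v w.
Proof.
move=> linr linl.
have sumr x I r (P : pred I) (c : I -> k) F :
  b x (\sum_(i <- r | P i) c i *: F i) = \sum_(i <- r | P i) c i *: b x (F i).
  have b0 : b x 0 = 0 by have := linr x (-1) 0 0; rewrite !scaleN1r !addNr.
  by elim/big_rec2: _ => // i y1 y2 _ <-; exact: linr.
have suml x I r (P : pred I) (c : I -> k) F :
  b (\sum_(i <- r | P i) c i *: F i) x = \sum_(i <- r | P i) c i *: b (F i) x.
  have b0 : b 0 x = 0 by have := linl x (-1) 0 0; rewrite !scaleN1r !addNr.
  by elim/big_rec2: _ => // i y1 y2 _ <-; exact: linl.
rewrite {2}[v]basisvE suml; apply: eq_bigr => i _.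
rewrite {2}[w]basisvE sumr scaler_sumr; apply: eq_bigr => j _.
by rewrite scalerA !mxE big_ord1 mxE.
Qed.

Lemma tprod_ext V W U (f g : {linear tens V W -> U}) :
  (forall v w, f (v ⊗ w) = g (v ⊗ w)) -> f =1 g.
Proof.
move=> fg t; have -> : t = \sum_i \sum_j (t : 'M_(_, _)) i j *:
    (basisv i ⊗ basisv j : tens V W).
  rewrite {1}[t : 'M_(_, _)]matrix_sum_delta; apply: eq_bigr => i _.
  apply: eq_bigr => j _; congr (_ *: _).
  by rewrite /tprod /basisv !r2vK trmx_delta mul_delta_mx.
rewrite !linear_sum; apply: eq_bigr => i _; rewrite !linear_sum.
by apply: eq_bigr => j _; rewrite !linearZ fg.
Qed.

End Tensor.

Notation "v ⊗ w" := (tprod v w) : ring_scope.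

Definition tmul (k : fieldType) (A B : falgType k) (s t : tens A B) : tens A B :=
  tlift (fun a b => tlift (fun c d => (a * c) ⊗ (b * d)) t) s.

(* Finite-dimensional Hopf algebra structures on a finite-dimensional unital  *)
(* associative k-algebra H.                                                   *)
Record hopf_algebra (k : fieldType) (H : falgType k) := HopfAlgebra {
  comul : 'Hom(H, tens H H);
  counit : 'Hom(H, k^o);
  antipode : 'End(H);
  comulA : forall x,
    tassoc (tmap comul id (comul x)) = tmap id comul (comul x);
  counitl : forall x, tlift (fun a b => (counit a : k) *: b) (comul x) = x;
  counitr : forall x, tlift (fun a b => (counit b : k) *: a) (comul x) = x;
  comul1 : comul 1 = 1 ⊗ 1;
  comulM : forall x y, comul (x * y) = tmul (comul x) (comul y);
  counit1 : counit 1 = 1;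
  counitM : forall x y, counit (x * y) = counit x * counit y;
  antipodel : forall x,
    tlift (fun a b => antipode a * b) (comul x) = (counit x : k)%:A;
  antipoder : forall x,
    tlift (fun a b => a * antipode b) (comul x) = (counit x : k)%:A
}.

Section HopfGalois.
Variables (k : fieldType) (H : falgType k) (A : hopf_algebra H).

Definition cocommutative := forall x, tswap (comul A x) = comul A x.

Definition sub_hopf_algebra (S : {vspace H}) :=
  [/\ 1 \in S,
      forall x y, x \in S -> y \in S -> x * y \in S,
      forall x, x \in S -> comul A x \in tensv S S
    & forall x, x \in S -> antipode A x \in S].

(* Here 1%VS is the line k.1 of H.                                            *)
Definition minimal_hopf_algebra :=
  (1%VS != fullv :> {vspace H}) /\
  (forall S : {vspace H}, sub_hopf_algebra S <-> S = 1%VS \/ S = fullv).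

Variable K : fieldExtType k.

Definition hopf_action (mu : 'Hom(H, 'End(K))) :=
  [/\ mu 1 = \1%VF,
      forall x y, mu (x * y) = (mu x \o mu y)%VF,
      forall x, mu x 1 = (counit A x : k)%:A
    & forall x s t,
        mu x (s * t) = tlift (fun a b => mu a s * mu b t) (comul A x)].

(* The map (1, mu) : K ⊗ H -> End_k(K).                                       *)
Definition galois_map (mu : 'Hom(H, 'End(K))) : tens K H -> 'End(K) :=
  tlift (fun s h => (amull s \o mu h)%VF).

Definition hopf_galois_structure (mu : 'Hom(H, 'End(K))) :=
  [/\ cocommutative, hopf_action mu & bijective (galois_map mu)].

End HopfGalois.

(* The group algebra L[Perm(T)], as a k-algebra; x : permalg L T stands for   *)
(* \sum_t (pcoef x t) t. Permutations are multiplied as in Perm(T), by composition  *)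
(* of functions; as (s * t)%g is t \o s, the coefficient of r in x * y is the *)
(* sum of the x t * y s over the t, s such that t \o s = r, i.e.,             *)
(* s = (r * t^-1)%g.                                                          *)

Definition permalg (k : fieldType) (L : fieldExtType k) (T : finType) : Type :=
  {ffun {perm T} -> L}.

HB.instance Definition _ (k : fieldType) (L : fieldExtType k) (T : finType) :=
  Vector.copy (permalg L T) {ffun {perm T} -> L}.

Definition pcoef (k : fieldType) (L : fieldExtType k) (T : finType)
  (x : permalg L T) : {perm T} -> L := fun_of_fin x.

Section PermAlgebra.
Variables (k : fieldType) (L : fieldExtType k) (T : finType).
Local Notation LT := (permalg L T).
Implicit Types (x y z : LT) (r s t : {perm T}).

Definition pone : LT := [ffun r => (r == 1%g)%:R].
Definition pmul x y : LT := [ffun r => \sum_t pcoef x t * pcoef y (r * t^-1)%g].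

Lemma permalgP x y : (forall r, pcoef x r = pcoef y r) <-> x = y.
Proof. by split=> [xy|-> //]; apply/ffunP. Qed.

Lemma poneE r : pcoef pone r = (r == 1%g)%:R. Proof. exact: ffunE. Qed.
Lemma pmulE x y r :
  pcoef (pmul x y) r = \sum_t pcoef x t * pcoef y (r * t^-1)%g.
Proof. exact: ffunE. Qed.
Lemma paddE x y r : pcoef (x + y) r = pcoef x r + pcoef y r.
Proof. exact: ffunE. Qed.
Lemma pscaleE (a : k) x r : pcoef (a *: x) r = a *: pcoef x r.
Proof. exact: ffunE. Qed.

Fact pmulA : associative pmul.
Proof.
move=> x y z; apply/permalgP => r; rewrite !pmulE.
under eq_bigr => t _ do rewrite pmulE mulr_sumr.
under [in RHS]eq_bigr => t _ do rewrite pmulE mulr_suml.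
rewrite [RHS]exchange_big; apply: eq_bigr => t _ /=.
rewrite (reindex_inj (mulIg t^-1%g)); apply: eq_bigr => s _ /=.
by rewrite mulrA invMg invgK mulgA mulgKV.
Qed.

Fact pmul1l : left_id pone pmul.
Proof.
move=> x; apply/permalgP => r; rewrite pmulE (bigD1 1%g) //= poneE eqxx mul1r.
rewrite invg1 mulg1 big1 ?addr0 // => t /negPf t1.
by rewrite poneE t1 mul0r.
Qed.

Fact pmul1r : right_id pone pmul.
Proof.
move=> x; apply/permalgP => r; rewrite pmulE (bigD1 r) //= poneE mulgV eqxx mulr1.
rewrite big1 ?addr0 // => t /negPf tr.
by rewrite poneE -eq_mulgV1 eq_sym tr mulr0.
Qed.

Fact pmulDl : left_distributive pmul +%R.
Proof.
move=> x y z; apply/permalgP => r; rewrite paddE !pmulE -big_split.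
by apply: eq_bigr => t _; rewrite paddE mulrDl.
Qed.

Fact pmulDr : right_distributive pmul +%R.
Proof.
move=> x y z; apply/permalgP => r; rewrite paddE !pmulE -big_split.
by apply: eq_bigr => t _; rewrite paddE mulrDr.
Qed.

Fact pone_neq0 : pone != 0.
Proof.
apply/eqP => /permalgP/(_ 1%g)/eqP.
by rewrite poneE eqxx /pcoef ffunE oner_eq0.
Qed.

HB.instance Definition _ := GRing.Zmodule_isNzRing.Build LT
  pmulA pmul1l pmul1r pmulDl pmulDr pone_neq0.

Fact pscaleAl (a : k) x y : a *: (x * y) = (a *: x) * y.
Proof.
apply/permalgP => r; rewrite pscaleE !pmulE scaler_sumr.
by apply: eq_bigr => t _; rewrite pscaleE scalerAl.
Qed.

HB.instance Definition _ := GRing.Lmodule_isLalgebra.Build k LT pscaleAl.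

Fact pscaleAr (a : k) x y : a *: (x * y) = x * (a *: y).
Proof.
apply/permalgP => r; rewrite pscaleE !pmulE scaler_sumr.
by apply: eq_bigr => t _; rewrite pscaleE scalerAr.
Qed.

HB.instance Definition _ := GRing.Lalgebra_isAlgebra.Build k LT pscaleAr.
HB.instance Definition _ := Algebra_isFalgebra.Build k LT.

End PermAlgebra.

Section GreitherPareigis.
Variables (k : fieldType) (L : splittingFieldType k) (K : {subfield L}).

Local Notation Gal_L := (gal_of {:L}).
Local Notation G := ('Gal({:L} / 1))%G.
Local Notation G' := ('Gal({:L} / K))%G.

(* As L is a splitting field over k, it is normal over k; it is the normal    *)
(* closure of K when no smaller normal extension of k contains K.             *)
Definition is_normal_closure :=
  forall E : {subfield L},
    (K <= E)%VS -> normalField 1 E -> E = fullv :> {vspace L}.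

(* In Gal_L, (x * y)%g is the automorphism y \o x. Thus the set of            *)
(* automorphisms gG' = {g \o h | h in G'} is the right coset (G' :* g)%g,     *)
(* and left translation by x, i.e., gG' |-> (x \o g)G', is the action of x    *)
(* on these by right multiplication.                                          *)
Definition gcoset := {C : {set Gal_L} | C \in rcosets G' G}.

Fact gcoset1_subproof : (G' : {set Gal_L}) \in rcosets G' G.
Proof. by apply/rcosetsP; exists 1%g; rewrite ?group1 ?rcoset1. Qed.

Definition gcoset1 : gcoset := Sub (G' : {set Gal_L}) gcoset1_subproof.

Definition ltrans : {morphism subact_dom _ 'Rs >-> {perm gcoset}} :=
  [morphism of actperm (subaction gcoset 'Rs)].

Lemma ltransE x (C : gcoset) : x \in G -> val (ltrans x C) = (val C :* x)%g.
Proof.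
move=> Gx; rewrite /= actpermE val_subact ifT /= ?rcosetE //.
rewrite /subact_dom /astabs !inE /=.
apply/subsetP=> D; rewrite !inE => /rcosetsP[y Gy ->] /=.
by apply/rcosetsP; exists (y * x)%g; rewrite ?groupM //= rcosetE rcosetM.
Qed.

Local Notation LPerm := (permalg L gcoset).
Implicit Types (a b : LPerm) (N : {group {perm gcoset}}).

(* The action of x in G on L[Perm(G/G')]; t ^ ltrans x is the permutation     *)
(* ltrans x \o t \o (ltrans x)^-1.                                            *)
Definition gp_act (x : Gal_L) a : LPerm :=
  [ffun t => x (pcoef a (t ^ (ltrans x)^-1)%g)].

Definition off_supp (A : {set {perm gcoset}}) a : LPerm :=
  [ffun t => if t \in A then 0 else pcoef a t].

Fact gp_act_is_linear x : linear (gp_act x).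
Proof.
by move=> c a b; apply/ffunP=> t; rewrite !ffunE paddE pscaleE linearP.
Qed.

HB.instance Definition _ x :=
  GRing.isLinear.Build k LPerm LPerm *:%R (gp_act x) (gp_act_is_linear x).

Fact off_supp_is_linear A : linear (off_supp A).
Proof.
move=> c a b; apply/ffunP=> t; rewrite !ffunE paddE pscaleE.
by case: ifP => // _; rewrite scaler0 addr0.
Qed.

HB.instance Definition _ A :=
  GRing.isLinear.Build k LPerm LPerm *:%R (off_supp A) (off_supp_is_linear A).

(* L[N]^G, as a k-subspace of L[Perm(G/G')].                                  *)
Definition gp_space N : {vspace LPerm} :=
  (lker (linfun (off_supp N)) :&:
   \bigcap_(x in G) fixedSpace (linfun (gp_act x)))%VS.

Lemma gp_spaceP N a :
  reflect ((forall t, t \notin N -> pcoef a t = 0) /\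
           (forall x, x \in G -> gp_act x a = a))
          (a \in gp_space N).
Proof.
rewrite memv_cap memv_ker lfunE; apply: (iffP andP) => -[].
  move=> /eqP supp fix_a; split=> [t Nt | x Gx].
    by move/permalgP/(_ t): supp; rewrite /pcoef !ffunE (negPf Nt).
  move: fix_a; rewrite memvE => /subv_bigcapP/(_ x Gx).
  by rewrite -memvE => /fixedSpaceP; rewrite lfunE.
move=> supp fix_a; split.
  by apply/eqP/ffunP => t; rewrite !ffunE; case: ifPn => // /supp.
rewrite memvE; apply/subv_bigcapP => x Gx; rewrite -memvE.
by apply/fixedSpaceP; rewrite lfunE /= fix_a.
Qed.

Fact gp_space_is_aspace N : is_aspace (gp_space N).
Proof.
have actE x a t : pcoef (gp_act x a) t = x (pcoef a (t ^ (ltrans x)^-1)%g).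
  exact: ffunE.
apply/andP; split.
  apply/has_algid1/gp_spaceP; split=> [t | x Gx].
    by rewrite poneE; case: eqP => // ->; rewrite group1.
  apply/permalgP=> t; rewrite actE !poneE conjg_eq1.
  by case: eqP; rewrite ?rmorph1 ?rmorph0.
apply/prodvP=> a b /gp_spaceP[suppa fixa] /gp_spaceP[suppb fixb].
apply/gp_spaceP; split=> [t Nt | x Gx].
  rewrite pmulE big1 // => s _.
  have [Ns | /suppa ->] := boolP (s \in N); last by rewrite mul0r.
  by rewrite suppb ?mulr0 // groupMr ?groupV.
apply/permalgP=> t; rewrite actE -{2}(fixa x Gx) -{2}(fixb x Gx) !pmulE.
rewrite rmorph_sum (reindex_inj (conjg_inj (ltrans x)^-1%g)).
by apply: eq_bigr => s _; rewrite rmorphM !actE conjMg conjVg.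
Qed.

Definition gp_algebra N : {aspace LPerm} := ASpace (gp_space_is_aspace N).

(* A and mu are the structures on L[N]^G and K prescribed by Greither and     *)
(* Pareigis: those of A are the restrictions of the L-Hopf algebra structure  *)
(* of L[N], given by t |-> t ⊗ t, t |-> 1 and t |-> t^-1 (an element of       *)
(* L[N] ⊗_L L[N] being identified with its coefficients on the s ⊗ t), and    *)
(* \sum_t c_t t acts on K by y |-> \sum_t c_t * g_t y, where g_t is any       *)
(* element of the coset t^-1(G').                                             *)
Record gp_structure N (A : hopf_algebra (subvs_of (gp_algebra N)))
    (mu : 'Hom(subvs_of (gp_algebra N), 'End(subvs_of K))) : Prop :=
  GPStructure {
    gp_comul : forall h s t,
      tlift (fun u v => pcoef (vsval u) s * pcoef (vsval v) t) (comul A h)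
        = if s == t then pcoef (vsval h) s else 0;
    gp_counit : forall h,
      (counit A h : k)%:A = \sum_t pcoef (vsval h) t;
    gp_antipode : forall h t,
      pcoef (vsval (antipode A h)) t = pcoef (vsval h) t^-1%g;
    gp_action : forall h y,
      vsval (mu h y) = \sum_t pcoef (vsval h) t *
        (repr (val (t^-1%g gcoset1)) : Gal_L) (vsval y)
  }.

End GreitherPareigis.

Definition normal_complement (gT : finGroupType) (N H G : {group gT}) :=
  [/\ N <| G, N :&: H = 1 & N * H = G]%g.

(* Main.v *)
From HB Require Import structures.
Require Import Defs.
From mathcomp Require Import all_boot all_order all_algebra.
From mathcomp Require Import all_fingroup all_solvable all_field.

Set Implicit Arguments.
Unset Strict Implicit.
Unset Printing Implicit Defensive.

Import GRing.Theory VectorInternalTheory.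
Local Open Scope ring_scope.

(* As K is separable with normal closure L, the extension L/k is Galois.      *)
(* By Galois descent (a trace argument together with Dedekind's               *)
(* independence of automorphisms), a k-basis of H = L[N]^G is an L-basis of   *)
(* L[N]. So elements of H, H ⊗ H and H ⊗ (H ⊗ H) are determined by their      *)
(* coefficients, which reduces the Hopf axioms to identities between group    *)
(* elements, and a G-equivariant family of coefficients always comes from H.  *)
(* A sub-Hopf algebra S consists of all elements of H supported on a          *)
(* G-stable subgroup of N, namely the union of the supports in S. As every    *)
(* automorphism of N is conjugation by an element of G', such a subgroup is   *)
(* characteristic, hence trivial or equal to N, i.e., S = k or S = H.         *)

(** Extending scalars to L turns H = L[P]^G, with P the image of N in Perm(G/G'), into the group
    algebra L[P]. Coefficients [ev s h] of a k-basis form a matrix invertible over L ([ev_free],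
    [ev_span]); its equivariant inverse ([ev_dual]) gives dim H = |P| and structure constants fixed
    by G, hence in k. So the Hopf structure of L[P] restricts to H ([grouplike_hopf_exists]).

    An element n of N acts on K through n^-1. As [K:k] = |N| and these restrictions to K are
    independent over L, the Galois map is injective between spaces of equal dimension
    ([complement_hopf_galois]).

    For minimality, contracting the comultiplication of a sub-Hopf algebra S against a coefficient
    isolates single group elements in L ⊗ S ([Lspan_delta]). So S is determined by its support, a
    G-stable subgroup of P ([mem_ev_support], [ev_support_group_set]). As G' induces all of Aut(N),
    this subgroup is characteristic, so it is 1 or P ([stable_sub_complement]). *)

Section GaloisFacts.
Variables (k : fieldType) (L : splittingFieldType k).
Implicit Types K E : {subfield L}.

(** The minimal polynomial of a primitive element of K is separable and splits in L; its roots
    generate a Galois extension of k containing K, which is L by minimality of the normal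
    closure. *)
Lemma normal_closure_galois K :
  separable 1 K -> is_normal_closure K -> galois 1 {:L}.
Proof.
move=> sepK closK.
have sepx := separable_generatorP K 1.
have defK := eq_adjoin_separable_generator sepK (sub1v K).
set x := separable_generator 1 K in sepx defK.
have [r _ Dp] := normalFieldP (normalFieldf 1) x (memvf x).
have galE : galois 1 <<1 & r>>%AS.
  apply/splitting_galoisField; exists (minPoly 1 x).
  by split; rewrite ?minPolyOver //; exists r; rewrite ?Dp ?eqpxx.
have defE : <<1 & r>>%VS = fullv.
  apply: closK; last by case/and3P: galE.
  rewrite defK; apply/FadjoinP; split; first exact: sub1v.
  by apply: seqv_sub_adjoin; rewrite -root_prod_XsubC -Dp root_minPoly.
by rewrite -defE.
Qed.

Lemma in_alg_of_fixed : galois 1 {:L} ->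
  forall a : L, (forall x, x \in 'Gal({:L} / 1)%g -> x a = a) ->
  {c : k | a = c%:A}.
Proof.
move=> galL a fixa; apply: sig_eqW; apply/vlineP.
by rewrite -(galois_fixedField galL); apply/fixedFieldP; rewrite ?memvf.
Qed.

Lemma galTrace_in_alg : galois 1 {:L} ->
  forall a : L, {c : k | galTrace 1 {:L} a = c%:A}.
Proof.
move=> galL a; apply: in_alg_of_fixed => //.
by have /mem_fixedFieldP[] := galTrace_fixedField 1 (memvf a).
Qed.

(** If a is nonzero, every b equals (b / a) a, so every trace would vanish, against independence of
    automorphisms. *)
Lemma galTrace_mulr_eq0 (a : L) :
  (forall l, galTrace 1 {:L} (l * a) = 0) -> a = 0.
Proof.
move=> tr0; apply: contraTeq isT => nz_a.
suffices /eqP: (1 : L) = 0 by rewrite oner_eq0.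
apply: (@gal_independent _ _ {:L}%AS [in 'Gal({:L} / 1)%g] (fun _ => 1)
   _ 1%g (group1 _)) => b _.
rewrite -[RHS](tr0 (b / a)) divfK //; apply: eq_bigr => x _; exact: mul1r.
Qed.

Lemma galTrace_eq1 : galois 1 {:L} -> exists l : L, galTrace 1 {:L} l = 1.
Proof.
move=> galL.
suffices [l nz_l] : exists l : L, galTrace 1 {:L} l != 0.
  have [c Dc] := galTrace_in_alg galL l.
  exists (c^-1 *: l).
  have nz_c : c != 0 by apply: contraNneq nz_l => c0; rewrite Dc c0 scale0r.
  rewrite /galTrace; under eq_bigr do rewrite linearZ.
  rewrite -scaler_sumr -/(galTrace _ _ _) Dc scalerA mulVf // scale1r //.
have [a _ nz] := @gal_independent_contra _ _ {:L}%AS [in 'Gal({:L} / 1)%g]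
  (fun _ => 1) 1%g (group1 _) (oner_neq0 _).
exists a; apply: contra_neq nz => tr0; rewrite -[RHS]tr0.
by apply: eq_bigr => x _; rewrite mul1r.
Qed.

(** Dedekind's theorem provides w for which the matrix of the x (w j) is invertible; c is the column
    of the inverse at x = 1. *)
Lemma gal_dual_family (A : {group gal_of {:L}}) :
  exists c w : 'I_#|A| -> L,
    forall x, x \in A -> \sum_i c i * x (w i) = (x == 1%g)%:R.
Proof.
have [w [_ _] [uM _ _]] := gal_matrix A; set M := \matrix_(i, j) _ in uM.
pose i1 := enum_rank_in (group1 A) (1%g : gal_of {:L}).
exists (fun j => invmx M j i1), (tnth w) => x Ax.
have := congr1 (fun B : 'M_#|A| => B (enum_rank_in Ax x) i1) (mulmxV uM).
rewrite !mxE => eM; transitivity ((enum_rank_in Ax x == i1)%:R : L).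
  rewrite -eM; apply: eq_bigr => j _.
  by rewrite mxE enum_rankK_in // mulrC.
by rewrite -(inj_eq enum_val_inj) !enum_rankK_in ?group1.
Qed.

End GaloisFacts.

(** * L-valued functionals on tensor products *)

Section TensorForms.
Variables (k : fieldType) (L : fieldExtType k).
Implicit Types U V W : vectType k.

Lemma eq_tlift V W U (b b' : V -> W -> U) y :
  (forall v w, b v w = b' v w) -> tlift b y = tlift b' y.
Proof.
move=> bb'; apply: eq_bigr => i _; apply: eq_bigr => j _.
by rewrite bb'.
Qed.

Lemma linear_tlift V W U U' (F : {linear U -> U'}) (b : V -> W -> U) y :
  F (tlift b y) = tlift (fun v w => F (b v w)) y.
Proof.
rewrite linear_sum; apply: eq_bigr => i _; rewrite linear_sum.
by apply: eq_bigr => j _; rewrite linearZ.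
Qed.

Lemma tlift_sum V W U (I : Type) (r : seq I) (P : pred I)
    (b : I -> V -> W -> U) y :
  tlift (fun v w => \sum_(i <- r | P i) b i v w) y =
    \sum_(i <- r | P i) tlift (b i) y.
Proof.
rewrite exchange_big; apply: eq_bigr => i _.
by rewrite exchange_big; apply: eq_bigr => j _; rewrite scaler_sumr.
Qed.

Lemma tlift_mulrl V W (c : L) (b : V -> W -> L) y :
  tlift (fun v w => c * b v w) y = c * tlift b y.
Proof.
rewrite mulr_sumr; apply: eq_bigr => i _; rewrite mulr_sumr.
by apply: eq_bigr => j _; rewrite scalerAr.
Qed.

Definition tform V W (f : V -> L) (g : W -> L) : tens V W -> L :=
  tlift (fun v w => f v * g w).

HB.instance Definition _ V W (f : V -> L) (g : W -> L) :=
  GRing.Linear.copy (tform f g) (tlift (fun v w => f v * g w)).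

Lemma tform_tprod V W (f : {linear V -> L}) (g : {linear W -> L}) v w :
  tform f g (v ⊗ w) = f v * g w.
Proof.
rewrite /tform tlift_tprod // => [u | u] a x y.
  by rewrite linearP mulrDr scalerAr.
by rewrite linearP mulrDl scalerAl.
Qed.

Lemma tform_tassoc U V W
    (f : {linear U -> L}) (g : {linear V -> L}) (h : {linear W -> L}) z :
  tform f (tform g h) (tassoc z) = tform (tform f g) h z.
Proof.
rewrite /tassoc linear_tlift [RHS]/tform; apply: eq_tlift => s w.
rewrite linear_tlift /= mulrC -tlift_mulrl. apply: eq_tlift => u v.
by rewrite tform_tprod /= tform_tprod mulrA mulrC.
Qed.

Lemma tform_tmap V W V' W' (f : {linear V' -> L}) (g : {linear W' -> L})
    (phi : V -> V') (psi : W -> W') y :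
  tform f g (tmap phi psi y) =
    tform (fun v => f (phi v)) (fun w => g (psi w)) y.
Proof.
rewrite /tmap linear_tlift [RHS]/tform.
by apply: eq_tlift => v w; apply: tform_tprod.
Qed.

Lemma tform_tswap V W (f : {linear V -> L}) (g : {linear W -> L}) y :
  tform g f (tswap y) = tform f g y.
Proof.
rewrite /tswap linear_tlift [RHS]/tform; apply: eq_tlift => v w.
by rewrite /= tform_tprod mulrC.
Qed.

Lemma tform_basis V W (f : V -> L) (g : W -> L) y :
  tform f g y =
    \sum_a \sum_b ((y : 'M_(_, _)) a b)%:A * f (basisv a) * g (basisv b).
Proof.
apply: eq_bigr => a _; apply: eq_bigr => b _.
by rewrite mulr_algl scalerAl.
Qed.

(** Joint injectivity of the f i on L ⊗ V, and not merely on V. *)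
Definition Lfree I V (f : I -> V -> L) :=
  forall c : 'I_(dim V) -> L,
    (forall i, \sum_a c a * f i (basisv a) = 0) -> forall a, c a = 0.

(** Expand the first factor in a basis: freeness over L kills each L-valued coefficient. Each is a g
    j at a vector of W with coordinates in k, and the g j separate W. *)
Lemma tform_eq0l I J V W (f : I -> V -> L) (g : J -> {linear W -> L}) y :
    Lfree f -> (forall w, (forall j, g j w = 0) -> w = 0) ->
  (forall i j, tform (f i) (g j) y = 0) -> y = 0.
Proof.
move=> freef sepg y0; apply/matrixP=> a b; rewrite mxE.
suffices: \sum_b (y : 'M_(_, _)) a b *: basisv b = 0 :> W.
  move/(congr1 (fun w => v2r w 0 b)); rewrite linear0 linear_sum summxE mxE.
  move=> e0; rewrite -[RHS]e0 (bigD1 b) //= big1 => [|c /negPf cb].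
    by rewrite linearZ /= /basisv r2vK !mxE !eqxx mulr1 addr0.
  by rewrite linearZ /= /basisv r2vK !mxE eq_sym cb mulr0.
apply: sepg => j; rewrite linear_sum.
under eq_bigr => c _ do rewrite linearZ /= -mulr_algl.
apply: (freef (fun a => \sum_b ((y : 'M_(_, _)) a b)%:A * g j (basisv b))) => i.
rewrite -[RHS](y0 i j) tform_basis; apply: eq_bigr => c _.
by rewrite mulr_suml; apply: eq_bigr => d _; rewrite mulrAC.
Qed.

Lemma tform_eq0r I J V W (f : I -> {linear V -> L}) (g : J -> W -> L) y :
    Lfree g -> (forall v, (forall i, f i v = 0) -> v = 0) ->
  (forall i j, tform (f i) (g j) y = 0) -> y = 0.
Proof.
move=> freeg sepf y0.
suffices: ((y : 'M_(_, _))^T : tens W V) = 0.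
  by move/(congr1 trmx); rewrite trmxK [in X in _ = X -> _]trmx0.
apply: (tform_eq0l freeg sepf) => j i; rewrite -[RHS](y0 i j) !tform_basis.
rewrite exchange_big; apply: eq_bigr => a _; apply: eq_bigr => b _.
by rewrite mxE mulrAC.
Qed.

End TensorForms.

(* ev s h stands for the coefficient of s in h; the conditions say that H is  *)
(* L[P]^G, where x in G acts on L and, through conjugation by lam x, on P.     *)
Record galois_form (k : fieldType) (L : splittingFieldType k) (H : falgType k)
    (gT : finGroupType) (P : {group gT}) (lam : gal_of {:L} -> gT)
    (ev : gT -> {linear (H : vectType k) -> (L : fieldExtType k)}) : Prop :=
  GaloisForm {
  lamM : {in 'Gal({:L} / 1)%g &, {morph lam : x y / (x * y)%g}};
  lamP : {in P & 'Gal({:L} / 1)%g, forall s x, (s ^ lam x)%g \in P};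
  eq_ev : forall h h', (forall s, ev s h = ev s h') -> h = h';
  ev_out : forall h s, s \notin P -> ev s h = 0;
  ev_gal : forall h x s, x \in 'Gal({:L} / 1)%g ->
    x (ev s h) = ev (s ^ lam x)%g h;
  ev_onto : forall f : gT -> L,
    (forall s, s \notin P -> f s = 0) ->
    (forall x s, x \in 'Gal({:L} / 1)%g -> x (f s) = f (s ^ lam x)%g) ->
    exists h, forall s, ev s h = f s;
  ev1 : forall s, ev s 1 = (s == 1%g)%:R;
  evM : forall s h h', ev s (h * h') = \sum_t ev t h * ev (s * t^-1)%g h'
}.

(** * Galois descent for coefficients *)

Section Descent.
Variables (k : fieldType) (L : splittingFieldType k) (H : falgType k).
Variables (gT : finGroupType) (P : {group gT}) (lam : gal_of {:L} -> gT).
Variable ev : gT -> {linear (H : vectType k) -> (L : fieldExtType k)}.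
Local Notation G := ('Gal({:L} / 1))%G.
Hypothesis galL : galois 1 {:L}.
Hypothesis formH : galois_form P lam ev.

Lemma lam1 : lam 1%g = 1%g.
Proof.
by apply: (mulgI (lam 1%g)); rewrite -(lamM formH) ?group1 // !mulg1.
Qed.

Lemma lamV x : x \in G -> lam x^-1%g = (lam x)^-1%g.
Proof.
move=> Gx; apply: (mulgI (lam x)).
by rewrite -(lamM formH) ?groupV // !mulgV lam1.
Qed.

Lemma ev_eq0 h : (forall s, ev s h = 0) -> h = 0.
Proof. by move=> h0; apply: (eq_ev formH) => s; rewrite h0 linear0. Qed.

(** With l of trace 1, write h as tr(l) h; equivariance of the coefficients then replaces each c i
    by tr(l c i), which lies in k. *)
Lemma ev_descent (S : {vspace H}) n (c : 'I_n -> L) (u : 'I_n -> H) h :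
    (forall i, u i \in S) -> (forall s, ev s h = \sum_i c i * ev s (u i)) ->
  h \in S.
Proof.
move=> Su Dh; have [l trl] := galTrace_eq1 galL.
have tr_alg := galTrace_in_alg galL.
suffices ->: h = \sum_i sval (tr_alg (l * c i)) *: u i.
  by apply: rpred_sum => i _; apply: rpredZ.
apply: (eq_ev formH) => s; rewrite linear_sum.
transitivity (galTrace 1 {:L} l * ev s h); first by rewrite trl mul1r.
rewrite mulr_suml.
under [RHS]eq_bigr => i _ do
  rewrite linearZ /= -mulr_algl -(svalP (tr_alg (l * c i))) mulr_suml.
rewrite [RHS]exchange_big; apply: eq_bigr => x Gx.
have -> t : ev t h = x (ev (t ^ (lam x)^-1)%g h).
  by rewrite (ev_gal formH) ?conjgKV.
rewrite Dh rmorph_sum mulr_sumr; apply: eq_bigr => i _.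
by rewrite !rmorphM /= mulrA (ev_gal formH) ?conjgKV.
Qed.

(** A relation over L, multiplied by l and traced, becomes a relation over k on a basis of H. So
    every tr(l c(a)) vanishes, and the trace form is nondegenerate. *)
Lemma ev_free : Lfree ev.
Proof.
move=> c c0 a; apply: galTrace_mulr_eq0 => l.
have tr_alg := galTrace_in_alg galL.
pose e b := sval (tr_alg (l * c b)).
suffices e0: \sum_b e b *: basisv b = 0 :> H.
  rewrite (svalP (tr_alg (l * c a))) -/(e a).
  suffices ->: e a = 0 by rewrite scale0r.
  move/(congr1 (fun w => v2r w 0 a)): e0; rewrite linear0 linear_sum summxE mxE.
  move=> <-; rewrite (bigD1 a) //= big1 => [|b /negPf ab].
    by rewrite linearZ /= /basisv r2vK !mxE !eqxx mulr1 addr0.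
  by rewrite linearZ /= /basisv r2vK !mxE eq_sym ab mulr0.
apply: (ev_eq0) => s; rewrite linear_sum.
under eq_bigr => b _ do
  rewrite linearZ /= -mulr_algl -(svalP (tr_alg (l * c b))) mulr_suml.
rewrite exchange_big big1 // => x Gx /=.
transitivity (x (l * \sum_b c b * ev (s ^ (lam x)^-1)%g (basisv b))).
  rewrite mulr_sumr rmorph_sum; apply: eq_bigr => b _.
  by rewrite !rmorphM /= mulrA (ev_gal formH) ?conjgKV.
by rewrite c0 mulr0 rmorph0.
Qed.

(** The sums over G of x (w i) times the conjugate of t by [lam x] lie in H; the dual family c
    extracts from them the term at x = 1, which is t. *)
Lemma ev_span t : t \in P ->
  exists d : 'I_(dim H) -> L,
    forall s, \sum_a d a * ev s (basisv a) = (s == t)%:R.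
Proof.
move=> Pt; have [c [w dual]] := gal_dual_family G.
have /fin_all_exists[u uE] : forall i, exists h, forall s, ev s h =
    \sum_(x in G) if (t ^ lam x)%g == s then x (w i) else 0.
  move=> i; apply: (ev_onto formH) => [s Ps | x s Gx].
    rewrite big1 // => x Gx; case: eqP => // Ds; case/negP: Ps.
    by rewrite -Ds (lamP formH).
  rewrite rmorph_sum [RHS](reindex_acts 'R _ Gx) ?astabsR //=.
  apply: eq_bigr => y Gy; rewrite (lamM formH) // conjgM (inj_eq (conjg_inj _)).
  by case: ifP; rewrite ?rmorph0 // galM ?memvf.
exists (fun a => \sum_i c i * (v2r (u i) 0 a)%:A) => s.
under eq_bigr => a _ do rewrite mulr_suml.
rewrite exchange_big /=.
transitivity (\sum_i c i * ev s (u i)).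
  apply: eq_bigr => i _; rewrite [in RHS](basisvE (u i)) linear_sum mulr_sumr.
  by apply: eq_bigr => a _; rewrite linearZ /= -mulrA mulr_algl.
under eq_bigr => i _ do rewrite uE mulr_sumr.
rewrite exchange_big /= (bigD1 1%g) ?group1 //=.
rewrite [X in _ + X]big1 => [|x /andP[Gx nx1]].
  rewrite addr0 lam1 conjg1 eq_sym; case: eqP => _; last first.
    by rewrite big1 // => i _; rewrite mulr0.
  by rewrite dual ?group1 ?eqxx.
case: eqP => _; last by rewrite big1 // => i _; rewrite mulr0.
by rewrite dual // (negPf nx1).
Qed.

(** [D] is inverse to the matrix of [ev] on a k-basis: column t holds the coordinates of t over L.
    [ev_span] gives one side; uniqueness of coordinates ([ev_free]) gives the other side and
    equivariance. *)
Lemma ev_dual : exists D : 'I_(dim H) -> gT -> L,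
  [/\ forall a t, t \notin P -> D a t = 0,
      forall s t, t \in P -> \sum_a D a t * ev s (basisv a) = (s == t)%:R,
      forall a b, \sum_(t in P) D a t * ev t (basisv b) = (a == b)%:R
    & forall a x t, x \in G -> x (D a t) = D a (t ^ lam x)%g].
Proof.
have /fin_all_exists[d dE] : forall t, exists d : 'I_(dim H) -> L,
   t \in P -> forall s, \sum_a d a * ev s (basisv a) = (s == t)%:R.
  move=> t; case: (boolP (t \in P)) => [/ev_span[d dE]|_]; first by exists d.
  by exists (fun=> 0).
pose D a t := if t \in P then d t a else 0.
have D1 s t : t \in P -> \sum_a D a t * ev s (basisv a) = (s == t)%:R.
  by rewrite /D => Pt; rewrite Pt dE.
exists D; split=> // [a t /negPf Pt | a b | a x t Gx].
- by rewrite /D Pt.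
- apply/eqP; rewrite -subr_eq0; apply/eqP; move: a.
  apply: ev_free => s; under eq_bigr => a _ do rewrite mulrBl mulr_suml.
  rewrite sumrB exchange_big (bigD1 b) //=.
  rewrite [\sum_(i < _ | _) _]big1 => [|a]; last first.
    by move=> /negPf->; rewrite mul0r.
  rewrite eqxx mul1r addr0; apply/eqP; rewrite subr_eq0; apply/eqP.
  transitivity (\sum_(t in P) ev t (basisv b) * (s == t)%:R).
    apply: eq_bigr => t Pt; rewrite -D1 // mulr_sumr.
    by apply: eq_bigr => a _; rewrite mulrAC mulrC.
  have [Ps | Ps] := boolP (s \in P); last first.
    rewrite (ev_out formH) // big1 // => t Pt.
    case: eqP => [Ds|]; last by rewrite mulr0.
    by rewrite Ds Pt in Ps.
  rewrite (bigD1 s) //= eqxx mulr1 big1 ?addr0 // => t /andP[_ /negPf].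
  by rewrite eq_sym => ->; rewrite mulr0.
- have [Pt | Pt] := boolP (t \in P); last first.
    have Ptx : (t ^ lam x)%g \notin P.
      apply: contra Pt => Ptx; rewrite -[t](conjgK (lam x)) -lamV //.
      by rewrite (lamP formH) ?groupV.
    by rewrite /D (negPf Pt) (negPf Ptx) rmorph0.
  apply/eqP; rewrite -subr_eq0; apply/eqP; move: a.
  apply: ev_free => s; under eq_bigr => a _ do rewrite mulrBl.
  rewrite sumrB D1 ?(lamP formH) //.
  transitivity (x (\sum_a D a t * ev (s ^ (lam x)^-1)%g (basisv a)) -
    (s == t ^ lam x)%g%:R).
    congr (_ - _); rewrite rmorph_sum; apply: eq_bigr => a _.
    by rewrite rmorphM /= (ev_gal formH) ?conjgKV.
  rewrite D1 // rmorph_nat -(inj_eq (conjg_inj (lam x))) conjgKV.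
  exact: subrr.
Qed.

Lemma dim_gp_algebra : dim H = #|P|.
Proof.
have [D [_ D1 D2 _]] := ev_dual.
pose A := \matrix_(a < dim H, i < #|P|) D a (enum_val i).
pose B := \matrix_(i < #|P|, a < dim H) ev (enum_val i) (basisv a).
have sumP (F : gT -> L) : \sum_(i < #|P|) F (enum_val i) = \sum_(t in P) F t.
  by rewrite [RHS]big_enum_val.
have AB : A *m B = 1%:M.
  apply/matrixP=> a b; rewrite !mxE -D2 -sumP; apply: eq_bigr => i _.
  by rewrite !mxE.
have BA : B *m A = 1%:M.
  apply/matrixP=> i j; rewrite !mxE -(inj_eq enum_val_inj) -D1 ?enum_valP //.
  by apply: eq_bigr => a _; rewrite !mxE mulrC.
apply/eqP; rewrite eqn_leq; apply/andP; split.
  by apply: mulmx1_min AB.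
by apply: mulmx1_min BA.
Qed.

End Descent.

(** * The Hopf algebra structure on H *)

Lemma sumr_delta (L : fieldType) (I : finType) (i : I) (F : I -> L) :
  \sum_j (j == i)%:R * F j = F i.
Proof.
rewrite (bigD1 i) //= eqxx mul1r big1 ?addr0 // => j /negPf->.
exact: mul0r.
Qed.

Lemma hom_on_basis (k : fieldType) (V W : vectType k) (w : 'I_(dim V) -> W) :
  exists f : 'Hom(V, W), forall v, f v = \sum_a v2r v 0 a *: w a.
Proof.
pose f v := \sum_a v2r v 0 a *: w a.
have flin : linear f.
  move=> c u v; rewrite /f scaler_sumr -big_split; apply: eq_bigr => a _ /=.
  by rewrite linearP !mxE scalerDl scalerA.
pose F : {linear V -> W} := HB.pack f (GRing.isLinear.Build _ _ _ _ f flin).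
by exists (linfun F) => v; rewrite lfunE.
Qed.

Record grouplike_hopf (k : fieldType) (L : fieldExtType k) (H : falgType k)
    (gT : finGroupType)
    (ev : gT -> {linear (H : vectType k) -> (L : fieldExtType k)})
    (A : hopf_algebra H) : Prop := GrouplikeHopf {
  ev_comul : forall h s t,
    tform (ev s) (ev t) (comul A h) = (s == t)%:R * ev s h;
  ev_counit : forall h, (counit A h : k)%:A = \sum_t ev t h;
  ev_antipode : forall h t, ev t (antipode A h) = ev t^-1%g h
}.

Section GroupAlgebraHopf.
Variables (k : fieldType) (L : splittingFieldType k) (H : falgType k).
Variables (gT : finGroupType) (P : {group gT}) (lam : gal_of {:L} -> gT).
Variable ev : gT -> {linear (H : vectType k) -> (L : fieldExtType k)}.
Local Notation G := ('Gal({:L} / 1))%G.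
Hypothesis galL : galois 1 {:L}.
Hypothesis formH : galois_form P lam ev.

Lemma ev_algid s (c : k) : ev s c%:A = c%:A * (s == 1%g)%:R.
Proof. by rewrite linearZ /= (ev1 formH) mulr_algl. Qed.

Lemma eq_ev2 (y z : tens H H) :
    (forall s t, tform (ev s) (ev t) y =
                 tform (ev s) (ev t) z) -> y = z.
Proof.
move=> yz; apply/eqP; rewrite -subr_eq0; apply/eqP.
apply: (tform_eq0l (ev_free galL formH) (ev_eq0 formH)) => s t.
by rewrite linearB /= yz subrr.
Qed.

Lemma eq_ev3 (y z : tens H (tens H H)) :
    (forall r s t,
       tform (ev r) (tform (ev s) (ev t)) y =
       tform (ev r) (tform (ev s) (ev t)) z) ->
  y = z.
Proof.
move=> yz; apply/eqP; rewrite -subr_eq0; apply/eqP.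
pose g (st : gT * gT) : {linear tens H H -> L} :=
  tform (ev st.1) (ev st.2).
apply: (@tform_eq0l _ _ _ _ _ _ _ g _ (ev_free galL formH)) => [w w0 | r [s t]].
  by apply: eq_ev2 => s t; rewrite linear0; apply: (w0 (s, t)).
by rewrite linearB /= yz subrr.
Qed.

(** The product of the tensor square is convolution on the direct square of the group. *)
Lemma tform_tmul s t (y z : tens H H) :
  tform (ev s) (ev t) (tmul y z) =
    \sum_p \sum_q tform (ev p) (ev q) y
      * tform (ev (s * p^-1)%g) (ev (t * q^-1)%g) z.
Proof.
rewrite /tmul linear_tlift.
transitivity (tlift (fun a b => \sum_p \sum_q
    tform (ev (s * p^-1)%g) (ev (t * q^-1)%g) z
      * (ev p a * ev q b)) y).
  apply: eq_tlift => a b; rewrite linear_tlift.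
  transitivity (tlift (fun c d => \sum_p \sum_q (ev p a * ev q b)
      * (ev (s * p^-1)%g c * ev (t * q^-1)%g d)) z).
    apply: eq_tlift => c d; rewrite /= tform_tprod /= !(evM formH) mulr_suml.
    apply: eq_bigr => p _; rewrite mulr_sumr; apply: eq_bigr => q _.
    by rewrite mulrACA.
  rewrite tlift_sum; apply: eq_bigr => p _.
  rewrite tlift_sum; apply: eq_bigr => q _.
  by rewrite tlift_mulrl mulrC.
rewrite tlift_sum; apply: eq_bigr => p _.
rewrite tlift_sum; apply: eq_bigr => q _.
by rewrite tlift_mulrl mulrC.
Qed.

Section HopfLaws.
Variables (D : 'Hom(H, tens H H)) (e : 'Hom(H, k^o)) (S : 'End(H)).
Hypothesis DE : forall h s t,
  tform (ev s) (ev t) (D h) = (s == t)%:R * ev s h.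
Hypothesis eE : forall h, (e h : k)%:A = \sum_t ev t h.
Hypothesis SE : forall h t, ev t (S h) = ev t^-1%g h.

Lemma gp_comulA x : tassoc (tmap D id (D x)) = tmap id D (D x).
Proof.
apply: eq_ev3 => r s t; rewrite tform_tassoc !tform_tmap /=.
transitivity (tlift (fun u v => (r == s)%:R * (ev r u * ev t v)) (D x)).
  by apply: eq_tlift => u v; rewrite /= DE mulrA.
transitivity (tlift (fun u v => (s == t)%:R * (ev r u * ev s v)) (D x)).
  rewrite !tlift_mulrl -!/(tform _ _ _) !DE.
  case: (r =P s) => [-> | _]; first by rewrite !mul1r.
  by rewrite !mul0r mulr0.
by apply: eq_tlift => u v; rewrite /= DE mulrCA.
Qed.

Lemma gp_counitl x : tlift (fun a b => (e a : k) *: b) (D x) = x.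
Proof.
apply: (eq_ev formH) => s; rewrite linear_tlift.
transitivity (tlift (fun a b => \sum_t ev t a * ev s b) (D x)).
  by apply: eq_tlift => a b; rewrite -mulr_suml -eE mulr_algl linearZ.
rewrite tlift_sum -(sumr_delta s (fun t => ev t x)).
by apply: eq_bigr => t _; apply: DE.
Qed.

Lemma gp_cocommutative x : tswap (D x) = D x.
Proof.
apply: eq_ev2 => s t; rewrite tform_tswap !DE eq_sym.
by case: eqP => [->|]; rewrite ?mul0r.
Qed.

Lemma gp_counitr x : tlift (fun a b => (e b : k) *: a) (D x) = x.
Proof.
apply: (eq_ev formH) => s; rewrite linear_tlift.
transitivity (tlift (fun a b => \sum_t ev s a * ev t b) (D x)).
  apply: eq_tlift => a b.
  by rewrite -mulr_sumr -eE mulrC mulr_algl linearZ.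
rewrite tlift_sum -(sumr_delta s (fun t => ev t x)).
apply: eq_bigr => t _; rewrite -/(tform _ _ _) DE eq_sym.
by case: eqP => [->|]; rewrite ?mul0r.
Qed.

Lemma gp_comul1 : D 1 = 1 ⊗ 1.
Proof.
apply: eq_ev2 => s t; rewrite DE tform_tprod /= !(ev1 formH).
case: (s =P t) => [-> | neq]; first by case: eqP; rewrite ?mul1r ?mul0r.
rewrite mul0r; case: eqP => [s1 | _]; rewrite ?mul0r // mul1r.
by case: eqP => // t1; case: neq; rewrite s1.
Qed.

Lemma gp_comulM x y : D (x * y) = tmul (D x) (D y).
Proof.
apply: eq_ev2 => s t; rewrite DE tform_tmul (evM formH) mulr_sumr.
apply: eq_bigr => p _; rewrite -(sumr_delta p (fun q => (s == t)%:R *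
  (ev q x * ev (s * q^-1)%g y))); apply: eq_bigr => q _.
rewrite !DE [p == q]eq_sym; case: (q =P p) => [-> | _]; last by rewrite !mul0r.
by rewrite !mul1r (inj_eq (mulIg _)) mulrCA.
Qed.

Lemma in_alg_inj_k (c d : k) : c%:A = d%:A :> L -> c = d.
Proof. exact: (fmorph_inj (in_alg L)). Qed.

Lemma gp_counit1 : e 1 = 1.
Proof.
apply: in_alg_inj_k; rewrite eE scale1r (bigD1 1%g) //= big1 => [|t /negPf t1].
  by rewrite (ev1 formH) eqxx addr0.
by rewrite (ev1 formH) t1.
Qed.

Lemma gp_counitM x y : e (x * y) = e x * e y.
Proof.
apply: in_alg_inj_k.
transitivity ((e x : k)%:A * (e y : k)%:A : L); last first.
  by rewrite mulr_algl scalerA.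
rewrite !eE mulr_suml.
under eq_bigr => s _ do rewrite (evM formH).
rewrite exchange_big; apply: eq_bigr => t _; rewrite mulr_sumr.
rewrite (reindex_inj (mulIg t)); apply: eq_bigr => s _.
by rewrite mulgK.
Qed.

(** Only terms with t^-1 = s t^-1 survive; this forces s = 1, where the coefficients add up to the
    counit. *)
Lemma gp_antipodel x : tlift (fun a b => S a * b) (D x) = (e x : k)%:A.
Proof.
apply: (eq_ev formH) => s; rewrite linear_tlift ev_algid.
transitivity (tlift (fun a b => \sum_t ev t^-1%g a * ev (s * t^-1)%g b) (D x)).
  apply: eq_tlift => a b; rewrite /= (evM formH).
  by apply: eq_bigr => t _; rewrite SE.
rewrite tlift_sum eE mulr_suml (reindex_inj invg_inj); apply: eq_bigr => t _.
by rewrite -/(tform _ _ _) invgK DE mulrC eq_sym eq_mulgV1 mulgK.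
Qed.

Lemma gp_antipoder x : tlift (fun a b => a * S b) (D x) = (e x : k)%:A.
Proof.
apply: (eq_ev formH) => s; rewrite linear_tlift ev_algid.
transitivity (tlift (fun a b => \sum_t ev t a * ev (t * s^-1)%g b) (D x)).
  apply: eq_tlift => a b; rewrite /= (evM formH).
  by apply: eq_bigr => t _; rewrite SE invMg invgK.
rewrite tlift_sum eE mulr_suml; apply: eq_bigr => t _.
by rewrite -/(tform _ _ _) DE mulrC eq_mulVg1 mulKg eq_invg1.
Qed.

End HopfLaws.

Lemma ev_basis s h : ev s h = \sum_a (v2r h 0 a)%:A * ev s (basisv a).
Proof.
rewrite [in LHS](basisvE h) linear_sum; apply: eq_bigr => a _.
by rewrite linearZ /= mulr_algl.
Qed.

(** G permutes the coefficients of a basis element, so their sum is fixed and lies in k. *)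
Lemma ev_counit_exists :
  exists e : 'Hom(H, k^o), forall h, (e h : k)%:A = \sum_t ev t h.
Proof.
have /fin_all_exists[c cE] : forall a, exists c : k,
    c%:A = \sum_t ev t (basisv a).
  move=> a; set z := \sum_t _.
  have [|c ->] := @in_alg_of_fixed _ _ galL z; last by exists c.
  move=> x Gx; rewrite rmorph_sum [RHS](reindex_inj (conjg_inj (lam x))).
  by apply: eq_bigr => t _; apply: (ev_gal formH).
have [e eE] := hom_on_basis (c : _ -> k^o); exists e => h; rewrite eE.
transitivity (\sum_a (v2r h 0 a)%:A * \sum_t ev t (basisv a)).
  rewrite scaler_suml; apply: eq_bigr => a _.
  by rewrite -cE mulr_algl scalerA.
under [RHS]eq_bigr => t _ do rewrite ev_basis.
by rewrite exchange_big; apply: eq_bigr => a _; rewrite mulr_sumr.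
Qed.

Lemma ev_antipode_exists :
  exists S : 'End(H), forall h t, ev t (S h) = ev t^-1%g h.
Proof.
have /fin_all_exists[u uE] : forall a, exists h, forall t,
    ev t h = ev t^-1%g (basisv a).
  move=> a; apply: (ev_onto formH) => [s Ps | x s Gx].
    by rewrite (ev_out formH) ?groupV.
  by rewrite (ev_gal formH) // conjVg.
have [S SE] := hom_on_basis u; exists S => h t.
rewrite SE [RHS]ev_basis linear_sum; apply: eq_bigr => a _.
by rewrite linearZ /= uE mulr_algl.
Qed.

(** Expanding the sum of the [ev t h] t ⊗ t in the basis of H by means of [ev_dual] gives
    coordinates invariant under G, hence in k. *)
Lemma ev_comul_exists : exists D : 'Hom(H, tens H H), forall h s t,
  tform (ev s) (ev t) (D h) = (s == t)%:R * ev s h.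
Proof.
have [d [_ d1 _ dG]] := ev_dual galL formH.
have /fin_all_exists[c cE] : forall abe : 'I_(dim H) * 'I_(dim H) * 'I_(dim H),
    exists c : k, c%:A = \sum_(t in P) d abe.1.1 t * d abe.1.2 t
                         * ev t (basisv abe.2).
  case=> [[a b] e] /=; set z := \sum_(t in P) _.
  have [|c ->] := @in_alg_of_fixed _ _ galL z; last by exists c.
  move=> x Gx; rewrite rmorph_sum /= [RHS](reindex_inj (conjg_inj (lam x))).
  apply: eq_big => [t | t Pt]; last first.
    by rewrite !rmorphM /= (ev_gal formH) ?dG.
  apply/idP/idP => [Pt | Ptx]; first exact: (lamP formH).
  rewrite -[t](conjgK (lam x)) -(lamV formH) //.
  by rewrite (lamP formH) ?groupV.
have [D DE] := hom_on_basis (fun e => \matrix_(a, b) c (a, b, e) : tens H H).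
exists D => h s t; rewrite DE [X in _ = _ * X]ev_basis linear_sum mulr_sumr.
apply: eq_bigr => e _; rewrite linearZ /= mulrCA mulr_algl; congr (_ *: _).
rewrite tform_basis.
transitivity (\sum_(r in P) ev r (basisv e) *
    ((\sum_a d a r * ev s (basisv a)) * (\sum_b d b r * ev t (basisv b)))).
  under [RHS]eq_bigr => r _ do rewrite mulr_suml mulr_sumr.
  rewrite [RHS]exchange_big; apply: eq_bigr => a _.
  under [RHS]eq_bigr => r _ do rewrite mulr_sumr mulr_sumr.
  rewrite [RHS]exchange_big; apply: eq_bigr => b _.
  rewrite mxE cE /= !mulr_suml.
  apply: eq_bigr => r _; rewrite [in RHS]mulrACA.
  by rewrite [RHS]mulrCA !mulrA.
under eq_bigr => r Pr do rewrite !d1 //.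
have [Ps | Ps] := boolP (s \in P); last first.
  rewrite (ev_out formH) // mulr0 big1 // => r Pr.
  case: eqP => [Ds | _]; first by rewrite Ds Pr in Ps.
  by rewrite mul0r mulr0.
rewrite (bigD1 s) //= eqxx mul1r big1 ?addr0 => [|r /andP[_ /negPf rs]].
  by rewrite mulrC [t == s]eq_sym.
by rewrite [s == r]eq_sym rs mul0r mulr0.
Qed.

Lemma grouplike_hopf_exists : exists A : hopf_algebra H, grouplike_hopf ev A.
Proof.
have [D DE] := ev_comul_exists; have [e eE] := ev_counit_exists.
have [S SE] := ev_antipode_exists.
by exists (HopfAlgebra (gp_comulA DE) (gp_counitl DE eE) (gp_counitr DE eE)
  (gp_comul1 DE) (gp_comulM DE) (gp_counit1 eE) (gp_counitM eE)
  (gp_antipodel DE eE SE) (gp_antipoder DE eE SE)).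
Qed.

Lemma grouplike_hopf_cocommutative (A : hopf_algebra H) :
  grouplike_hopf ev A -> cocommutative A.
Proof. by move=> [DE _ _] x; apply: gp_cocommutative. Qed.

End GroupAlgebraHopf.

(** * Tensor products of subspaces *)

Section TensorSubspace.
Variable k : fieldType.
Implicit Types V W : vectType k.

Lemma tprod_linearl V W (w : W) : linear (fun v : V => v ⊗ w).
Proof. by move=> c u v; rewrite /tprod !linearP /= mulmxDl -scalemxAl. Qed.

Lemma tprod_linearr V W (v : V) : linear (fun w : W => v ⊗ w).
Proof. by move=> c u w; rewrite /tprod !linearP. Qed.

Lemma mem_tensv V W (A : {vspace V}) (B : {vspace W}) v w :
  v \in A -> w \in B -> v ⊗ w \in tensv A B.
Proof.
move=> Av Bw.
pose fl w : {linear V -> tens V W} := HB.pack (fun v : V => v ⊗ w)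
  (GRing.isLinear.Build _ _ _ _ _ (@tprod_linearl V W w)).
pose fr v : {linear W -> tens V W} := HB.pack (fun w : W => v ⊗ w)
  (GRing.isLinear.Build _ _ _ _ _ (@tprod_linearr V W v)).
rewrite (coord_vbasis Av) -[_ ⊗ w]/(fl w _) linear_sum rpred_sum // => i _.
rewrite linearZ rpredZ //= (coord_vbasis Bw) -[_ ⊗ _]/(fr _ _) linear_sum.
rewrite rpred_sum // => j _; rewrite linearZ rpredZ //=; apply: memv_span.
by apply: allpairs_f; apply: mem_nth; rewrite size_tuple.
Qed.

Lemma tensv_fullv V W : tensv (fullv : {vspace V}) (fullv : {vspace W}) = fullv.
Proof.
apply/vspaceP=> y; rewrite memvf; apply/idP.
have -> : y = tlift (fun v w => v ⊗ w) y.
  apply: (@tprod_ext _ _ _ _ idfun (tlift (fun v w => v ⊗ w))) => v w.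
  rewrite /= tlift_tprod // => u; first exact: tprod_linearr.
  exact: tprod_linearl.
by do 2![apply: rpred_sum => ? _]; rewrite rpredZ ?mem_tensv ?memvf.
Qed.

End TensorSubspace.

(** * Sub-Hopf algebras and their supports *)

Section SubHopfAlgebras.
Variables (k : fieldType) (L : splittingFieldType k) (H : falgType k).
Variables (gT : finGroupType) (P : {group gT}) (lam : gal_of {:L} -> gT).
Variable ev : gT -> {linear (H : vectType k) -> (L : fieldExtType k)}.
Local Notation G := ('Gal({:L} / 1))%G.
Hypothesis galL : galois 1 {:L}.
Hypothesis formH : galois_form P lam ev.

Section LinearSpan.
Variable S : {vspace H}.

(** The extension of scalars L ⊗ S, realized as a space of functions on the group. *)
Definition Lspan (F : gT -> L) :=
  exists c : 'I_(\dim S) -> L, forall t, F t = \sum_i c i * ev t (vbasis S)`_i.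

Lemma Lspan_ev u : u \in S -> Lspan (fun t => ev t u).
Proof.
move=> Su; exists (fun i => (coord (vbasis S) i u)%:A) => t.
rewrite [in LHS](coord_vbasis Su) linear_sum; apply: eq_bigr => i _.
by rewrite linearZ /= mulr_algl.
Qed.

Lemma Lspan_sum (I : finType) (a : I -> L) (F : I -> gT -> L) :
    (forall i, a i != 0 -> Lspan (F i)) ->
  Lspan (fun t => \sum_i a i * F i t).
Proof.
move=> spanF.
have /fin_all_exists[c cE] : forall i, exists c : 'I_(\dim S) -> L,
    a i != 0 -> forall t, F i t = \sum_j c j * ev t (vbasis S)`_j.
  move=> i; case: (boolP (a i == 0)) => [_ | /spanF[c cE]]; last by exists c.
  by exists (fun=> 0).
exists (fun j => \sum_i a i * c i j) => t.
under [RHS]eq_bigr => j _ do rewrite mulr_suml.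
rewrite [RHS]exchange_big; apply: eq_bigr => i _ /=.
have [-> | nz_ai] := eqVneq (a i) 0.
  by rewrite mul0r big1 // => j _; rewrite !mul0r.
by rewrite cE // mulr_sumr; apply: eq_bigr => j _; rewrite mulrA.
Qed.

Lemma Lspan_descent h : Lspan (fun t => ev t h) -> h \in S.
Proof.
case=> c cE; apply: (ev_descent galL formH) cE => i.
by apply/vbasis_mem/mem_nth; rewrite size_tuple.
Qed.

(** A pure tensor u ⊗ v of S ⊗ S contributes [ev s v] times the coefficients of u. *)
Lemma Lspan_tensv y s :
  y \in tensv S S -> Lspan (fun t => tform (ev t) (ev s) y).
Proof.
rewrite /tensv; set X := [seq _ | _ <- _, _ <- _] => Xy.
have [c cE] : Lspan (fun t => \sum_i (coord (in_tuple X) i y)%:A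
    * tform (ev t) (ev s) X`_i).
  apply: Lspan_sum => i _.
  have /allpairsP[[u v] [/= Su Sv ->]] := mem_nth 0 (ltn_ord i).
  (* A sum over [unit] serves as a single scalar multiple. *)
  have [c cE] := Lspan_sum (I := unit) (a := fun=> ev s v)
    (fun _ _ => Lspan_ev (vbasis_mem Su)).
  exists c => t; rewrite -cE big_const card_unit /= addr0.
  by rewrite tform_tprod mulrC.
exists c => t; rewrite -cE [in LHS](coord_span (X := in_tuple X) Xy) linear_sum.
by apply: eq_bigr => i _; rewrite linearZ /= mulr_algl.
Qed.

End LinearSpan.

Variable A : hopf_algebra H.
Hypothesis hopfA : grouplike_hopf ev A.

Definition ev_support (S : {vspace H}) : {set gT} :=
  [set s | has (fun h => ev s h != 0) (vbasis S)].

Lemma ev_supportP (S : {vspace H}) s :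
  reflect (exists2 h, h \in S & ev s h != 0) (s \in ev_support S).
Proof.
rewrite inE; apply: (iffP hasP) => [[h Sh nz] | [h Sh nz]].
  by exists h; rewrite ?vbasis_mem.
apply/hasP; apply: contraNT nz => /hasPn ev0.
rewrite (coord_vbasis Sh) linear_sum big1 // => i _; rewrite linearZ /=.
have /ev0 : (vbasis S)`_i \in vbasis S by rewrite mem_nth ?size_tuple.
by rewrite negbK => /eqP->; rewrite scaler0.
Qed.

Variable S : {vspace H}.
Hypothesis subS : sub_hopf_algebra A S.

(* Applying [ev s] to the second factor of [comul h] in S ⊗ S shows that      *)
(* [ev s h * delta_s] is in the L-span of S.                                  *)
Lemma Lspan_delta s : s \in ev_support S -> Lspan S (fun t => (t == s)%:R).
Proof.
case/ev_supportP=> h Sh nz_h; have [_ _ comulS _] := subS.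
have spanh := Lspan_tensv s (comulS h Sh).
have [c cE] := Lspan_sum (I := unit) (a := fun=> (ev s h)^-1)
  (fun _ _ => spanh).
exists c => t; rewrite -cE big_const card_unit /= addr0 (ev_comul hopfA).
case: (t =P s) => [-> | _]; last by rewrite mul0r mulr0.
by rewrite mul1r mulVf.
Qed.

(** An element supported on the support of S is an L-combination of delta functions lying in L ⊗ S;
    descent puts it back in S. *)
Lemma mem_ev_support h :
  (h \in S) = [forall s, (ev s h != 0) ==> (s \in ev_support S)].
Proof.
apply/idP/forall_inP => [Sh s nz | supph]; first by apply/ev_supportP; exists h.
apply: Lspan_descent.
have [c cE] : Lspan S (fun t => \sum_s ev s h * (t == s)%:R).
  by apply: Lspan_sum => s /supph; apply: Lspan_delta.
exists c => t; rewrite -cE -[LHS](sumr_delta t (fun s => ev s h)).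
by apply: eq_bigr => s _; rewrite mulrC [t == s]eq_sym.
Qed.

(** If s and t are in the support, then L ⊗ S contains both delta functions, hence their product. In
    a finite group, closure under products gives a subgroup. *)
Lemma ev_support_group_set : group_set (ev_support S).
Proof.
have [S1 mulS _ _] := subS; apply/group_setP; split=> [|s t].
  by apply/ev_supportP; exists 1; rewrite // (ev1 formH) eqxx oner_neq0.
move=> /Lspan_delta[c cE] /Lspan_delta[d dE]; apply: contraTT isT => st.
have ev_st u : u \in S -> ev (s * t)%g u = 0.
  by move=> Su; apply: contraNeq st => nz; apply/ev_supportP; exists u.
suffices /eqP: (1 : L) = 0 by rewrite oner_eq0.
(* This is the coefficient at s t of the product of the delta functions at t and s: it is 1, yet it
   vanishes if s t is outside the support. *)
transitivity (\sum_p (p == t)%:R * (s * t * p^-1 == s)%g%:R : L).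
  by rewrite sumr_delta mulgK eqxx.
have memS i : (vbasis S)`_i \in S.
  have [lti | gei] := ltnP i (\dim S); last first.
    by rewrite nth_default ?size_tuple ?mem0v.
  by rewrite vbasis_mem ?mem_nth ?size_tuple.
transitivity (\sum_i \sum_j d i * c j *
    ev (s * t)%g ((vbasis S)`_i * (vbasis S)`_j)); last first.
  by rewrite big1 // => i _; rewrite big1 // => j _; rewrite ev_st ?mulr0 ?mulS.
under eq_bigr => p _ do rewrite dE cE mulr_suml.
rewrite exchange_big; apply: eq_bigr => i _ /=.
under eq_bigr => p _ do rewrite mulr_sumr.
rewrite exchange_big; apply: eq_bigr => j _ /=.
rewrite (evM formH) mulr_sumr; apply: eq_bigr => p _.
by rewrite mulrACA.
Qed.

Lemma ev_support_stable :
  {in ev_support S & G, forall s x, (s ^ lam x)%g \in ev_support S}.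
Proof.
move=> s x /ev_supportP[h Sh nz] Gx; apply/ev_supportP; exists h => //.
by rewrite -(ev_gal formH) // fmorph_eq0.
Qed.

Lemma ev_support_sub : ev_support S \subset P.
Proof.
apply/subsetP=> s /ev_supportP[h _]; apply: contraR => Ps.
by rewrite (ev_out formH).
Qed.

End SubHopfAlgebras.

(** * Minimality from stable subgroups *)

Section Minimality.
Variables (k : fieldType) (L : splittingFieldType k) (H : falgType k).
Variables (gT : finGroupType) (P : {group gT}) (lam : gal_of {:L} -> gT).
Variable ev : gT -> {linear (H : vectType k) -> (L : fieldExtType k)}.
Local Notation G := ('Gal({:L} / 1))%G.
Hypothesis galL : galois 1 {:L}.
Hypothesis formH : galois_form P lam ev.
Variable A : hopf_algebra H.
Hypothesis hopfA : grouplike_hopf ev A.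

Lemma sub_hopf_1 : sub_hopf_algebra A 1%VS.
Proof.
have mem1 : 1 \in (1%VS : {vspace H}) by rewrite memv_line.
split=> // [x y /vlineP[c ->] /vlineP[d ->] | x /vlineP[c ->] | x /vlineP[c ->]].
- by rewrite -scalerAl mul1r !rpredZ.
- rewrite linearZ rpredZ //= comul1; exact: mem_tensv.
rewrite linearZ rpredZ //=; suffices ->: antipode A 1 = 1 by [].
by apply: (eq_ev formH) => s; rewrite (ev_antipode hopfA) !(ev1 formH) eq_invg1.
Qed.

Lemma sub_hopf_fullv : sub_hopf_algebra A fullv.
Proof. by split=> *; rewrite ?tensv_fullv ?memvf. Qed.

(** A support equal to P gives all of H; a trivial one gives k, since coefficients at 1 are fixed by
    G. *)
Lemma minimal_hopf_of_stable :
    P :!=: 1%g ->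
    (forall Q : {group gT}, Q \subset P ->
      {in Q & G, forall s x, (s ^ lam x)%g \in Q} ->
      Q :=: 1%g \/ Q :=: P) ->
  minimal_hopf_algebra A.
Proof.
move=> ntP minP; split.
  apply: contraNneq ntP => e1; rewrite trivg_card1.
  by rewrite -(dim_gp_algebra galL formH) -(dimvf H) -e1 dimv1.
move=> S; split=> [subS | [] ->]; [|exact: sub_hopf_1|exact: sub_hopf_fullv].
have [S1 _ _ _] := subS.
pose Q := Group (ev_support_group_set formH hopfA subS).
have memS := mem_ev_support galL formH hopfA subS.
have [||Q1|QP] := minP Q.
- exact: (ev_support_sub formH).
- exact: (ev_support_stable formH).
- left; apply/vspaceP=> h; apply/idP/idP=> [|/vlineP[c ->]]; last exact: rpredZ.
  rewrite memS => /forall_inP supph; apply/vlineP.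
  have [x Gx | c cE] := @in_alg_of_fixed _ _ galL (ev 1%g h).
    by rewrite (ev_gal formH) ?conj1g.
  exists c; apply: (eq_ev formH) => s; rewrite (ev_algid formH) -cE.
  have [-> | s1] := eqVneq s 1%g; first by rewrite mulr1.
  rewrite mulr0; apply: contraNeq s1 => /supph.
  by rewrite -[_ \in _]/(s \in gval Q) Q1 => /set1P->.
right; apply/vspaceP=> h; rewrite memvf memS; apply/forall_inP => s.
by apply: contraR; rewrite -[_ \in _]/(s \in gval Q) QP => /(ev_out formH)->.
Qed.

End Minimality.

(** * The action on K and the Galois map *)

Lemma lfun_bij (k : fieldType) (V W : vectType k) (f : {linear V -> W}) :
  dim V = dim W -> (forall v, f v = 0 -> v = 0) -> bijective f.
Proof.
move=> dimVW f0; pose F := linfun f.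
have kerF : lker F == 0%VS.
  rewrite -subv0; apply/subvP => v; rewrite memv_ker lfunE /= => /eqP/f0->.
  exact: mem0v.
have imF : limg F = fullv.
  apply/eqP; rewrite eqEdim subvf /= limg_dim_eq ?(eqP kerF) ?capv0 //.
  by rewrite !dimvf dimVW.
exists (F^-1)%VF => [v | w].
  by rewrite -{2}(lker0_lfunK kerF v) lfunE.
by rewrite -[f _]lfunE limg_lfunVK // imF memvf.
Qed.

Section ComplementAction.
Variables (k : fieldType) (L : splittingFieldType k) (K : {subfield L}).
Variable N : {group gal_of {:L}}.
Local Notation G := ('Gal({:L} / 1))%G.
Local Notation G' := ('Gal({:L} / K))%G.
Hypothesis galL : galois 1 {:L}.
Hypothesis complN : normal_complement N G' G.

Lemma complement_sub : N \subset G.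
Proof. by case: complN => /normal_sub. Qed.

Lemma fixed_sub (y : L) : (forall x, x \in G' -> x y = y) -> y \in K.
Proof.
have galK : galois K {:L} by apply: galoisS galL; rewrite sub1v subvf.
move=> fixy; rewrite -(galois_fixedField galK).
by apply/fixedFieldP; rewrite ?memvf.
Qed.

Lemma dim_complement : \dim K = #|N|.
Proof.
have galK : galois K {:L} by apply: galoisS galL; rewrite sub1v subvf.
have [_ TI defG] := complN.
have := galois_dim galL.
rewrite dimv1 divn1 -defG TI_cardMg // -(galois_dim galK).
rewrite -{1}(divnK (field_dimS (subvf K))) mulnC.
by move/eqP; rewrite eqn_pmul2r ?divn_gt0 ?adim_gt0 ?dimvS ?subvf // => /eqP.
Qed.

Lemma sum_complement (F : gal_of {:L} -> L) :
  \sum_(x in G) F x = \sum_(n in N) \sum_(g in G') F (n * g)%g.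
Proof.
have [_ TI defG] := complN.
rewrite (partition_big (divgr N G') [in N]) /= => [|x Gx]; last first.
  by apply: mem_divgr; rewrite defG.
apply: eq_bigr => n Nn; rewrite (reindex_inj (mulgI n)); apply: eq_bigl => g.
have Gn := subsetP complement_sub _ Nn.
apply/andP/idP => [[Gng /eqP Dn] | G'g].
  have := divgr_eq N G' (n * g); rewrite Dn => /mulgI->.
  by apply: mem_remgr; rewrite defG.
rewrite groupM ?(subsetP (galS {:L} (sub1v K)) g) //; split=> //.
by rewrite divgrMid.
Qed.

(* Dedekind's theorem for the restrictions to K of the inverses of N, which   *)
(* reduces to that for L by evaluating at the traces from L to K.             *)
Lemma complement_independent (c : gal_of {:L} -> L) :
    (forall y, y \in K -> \sum_(n in N) c n * n^-1%g y = 0) ->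
  forall n, n \in N -> c n = 0.
Proof.
move=> c0 n Nn; have [_ TI defG] := complN.
(* As G = N G', [d] equals c n at (n g)^-1 for every g in G', so the sum of the d x x(a) collects
   into the sum of the c n n^-1(tr a), with tr the trace to K. *)
pose d x := c (divgr N G' x^-1%g).
have -> : c n = d n^-1%g by rewrite /d invgK -{2}[n]mulg1 divgrMid.
have Gn := subsetP complement_sub _ Nn.
apply: (@gal_independent _ _ {:L}%AS [in G] d _ n^-1%g); last first.
  by rewrite /= groupV.
move=> a _; have tra_K : galTrace K {:L} a \in K.
  have /mem_fixedFieldP[_ fixa] := galTrace_fixedField K (memvf a).
  exact: fixed_sub.
rewrite -[RHS](c0 _ tra_K) (reindex_inj invg_inj) /=.
under eq_bigl => x do rewrite groupV.
rewrite sum_complement; apply: eq_bigr => m Nm.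
rewrite /galTrace rmorph_sum mulr_sumr [RHS](reindex_inj invg_inj) /=.
under [RHS]eq_bigl => x do rewrite groupV.
apply: eq_bigr => g G'g; rewrite /d invgK divgrMid // invMg galM ?memvf //.
Qed.

Variables (H : falgType k) (gT : finGroupType) (P : {group gT}).
Variables (lam : gal_of {:L} -> gT).
Variable ev : gT -> {linear (H : vectType k) -> (L : fieldExtType k)}.
Hypothesis formH : galois_form P lam ev.
Hypothesis lam_inj : {in N &, injective lam}.
Hypothesis defP : P = lam @: N :> {set gT}.
Variable A : hopf_algebra H.
Hypothesis hopfA : grouplike_hopf ev A.

Lemma lam_eq : {in N &, forall n m, (lam n == lam m) = (n == m)}.
Proof. exact: inj_in_eq. Qed.

Lemma sum_ev h (F : gT -> L) :
  \sum_t ev t h * F t = \sum_(n in N) ev (lam n) h * F (lam n).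
Proof.
rewrite -(big_imset (fun t => ev t h * F t) lam_inj) /= -defP.
rewrite [RHS]big_mkcond; apply: eq_bigr => t _.
by case: ifPn => // /(ev_out formH)->; rewrite mul0r.
Qed.

(** The Greither-Pareigis action on K: if t is the image of n, then t^-1 sends the base coset G' to
    the coset of n^-1. *)
Definition complement_act (h : H) (y : L) : L :=
  \sum_(n in N) ev (lam n) h * n^-1%g y.

(** An x in G' fixes y and permutes N by conjugation, so it only permutes the terms of the sum. *)
Lemma complement_act_mem h y : y \in K -> complement_act h y \in K.
Proof.
move=> Ky; apply: fixed_sub => x G'x.
have Gx := subsetP (galS _ (sub1v K)) x G'x.
have [/andP[_ /subsetP nNG] _ _] := complN.
rewrite rmorph_sum [RHS](reindex_inj (conjg_inj x)).
apply: eq_big => [n | n Nn]; first by rewrite memJ_norm ?nNG.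
have Gn := subsetP complement_sub _ Nn.
rewrite rmorphM /= (ev_gal formH) // /conjg !(lamM formH) ?groupM ?groupV //.
rewrite (lamV formH) //; congr (_ * _).
rewrite -/(n ^ x)%g -conjVg conjgE !galM ?memvf //.
by rewrite (fixed_gal (subvf K) (groupVr G'x) Ky).
Qed.

Lemma complement_act_linearl y : linear (complement_act^~ y).
Proof.
move=> c h h'; rewrite /complement_act scaler_sumr -big_split.
by apply: eq_bigr => n _; rewrite linearP mulrDl scalerAl.
Qed.

Lemma complement_act_linearr h : linear (complement_act h).
Proof.
move=> c y z; rewrite /complement_act scaler_sumr -big_split.
by apply: eq_bigr => n _; rewrite linearP mulrDr scalerAr.
Qed.

Lemma complement_action_exists : exists mu : 'Hom(H, 'End(subvs_of K)),
  forall h y, vsval (mu h y) = complement_act h (vsval y).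
Proof.
pose f h (y : subvs_of K) := vsproj K (complement_act h (vsval y)).
have fE h y : vsval (f h y) = complement_act h (vsval y).
  by rewrite vsprojK // complement_act_mem ?subvsP.
have f_lin h : linear (f h).
  move=> c y z; apply: val_inj; rewrite /= fE !linearP /= !fE.
  exact: complement_act_linearr.
pose F h : {linear subvs_of K -> subvs_of K} :=
  HB.pack (f h) (GRing.isLinear.Build _ _ _ _ _ (f_lin h)).
have [mu muE] := hom_on_basis (fun a => linfun (F (basisv a))).
exists mu => h y; rewrite muE sum_lfunE linear_sum.
pose Fl : {linear H -> L} := HB.pack (complement_act^~ (vsval y))
  (GRing.isLinear.Build _ _ _ _ _ (complement_act_linearl (vsval y))).
rewrite [in RHS](basisvE h) -[RHS]/(Fl _) linear_sum; apply: eq_bigr => a _.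
by rewrite [RHS]linearZ scale_lfunE linearZ lfunE /= fE.
Qed.

Variable mu : 'Hom(H, 'End(subvs_of K)).
Hypothesis muE : forall h y, vsval (mu h y) = complement_act h (vsval y).

Lemma complement_hopf_action : hopf_action A mu.
Proof.
split=> [|x y|x|x s t].
- apply/lfunP=> y; apply: val_inj; rewrite /= muE id_lfunE.
  rewrite /complement_act (bigD1 1%g) ?group1 //= big1 => [|n /andP[Nn n1]].
    by rewrite (lam1 formH) (ev1 formH) eqxx mul1r addr0 invg1 gal_id.
  by rewrite (ev1 formH) -(lam1 formH) lam_eq // (negPf n1) mul0r.
- apply/lfunP=> z; apply: val_inj; rewrite /= muE comp_lfunE !muE.
  rewrite /complement_act.
  under eq_bigr => n _ do rewrite (evM formH) sum_ev mulr_suml.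
  rewrite exchange_big; apply: eq_bigr => m Nm /=.
  have Gm := subsetP complement_sub _ Nm.
  (* Substituting m n for n matches the terms, as m^-1 takes the coefficient of y at n to the one at
     m n m^-1. *)
  rewrite rmorph_sum mulr_sumr (reindex_inj (mulgI m)).
  apply: eq_big => [n | n Nmn]; first by rewrite groupMl.
  have Nn : n \in N by rewrite groupMl in Nmn.
  have Gn := subsetP complement_sub _ Nn.
  rewrite rmorphM /= -mulrA (ev_gal formH) ?groupV // invMg galM ?memvf //.
  rewrite /conjg !(lamV formH) // invgK.
  by rewrite !(lamM formH) ?groupM ?groupV // mulgA.
- apply: val_inj; rewrite /= muE /= algid1.
  rewrite (ev_counit hopfA) /complement_act.
  under eq_bigr => n _ do rewrite rmorph1.
  rewrite -(sum_ev x (fun=> 1)); apply: eq_bigr => t _; exact: mulr1.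
apply: val_inj; rewrite /= muE linear_tlift /=.
transitivity (tlift (fun a b => \sum_(n in N) \sum_(m in N)
   (n^-1%g (vsval s) * m^-1%g (vsval t)) * (ev (lam n) a * ev (lam m) b))
   (comul A x)); last first.
  apply: eq_tlift => a b; rewrite !muE /complement_act mulr_suml.
  apply: eq_bigr => n _; rewrite mulr_sumr; apply: eq_bigr => m _.
  by rewrite [RHS]mulrACA [RHS]mulrC.
rewrite tlift_sum; apply: eq_bigr => n Nn; rewrite tlift_sum (bigD1 n) //=.
rewrite big1 ?addr0 => [|m /andP[Nm /negPf mn]];
  rewrite tlift_mulrl -/(tform _ _ _) (ev_comul hopfA).
  by rewrite eqxx mul1r rmorphM mulrC.
by rewrite lam_eq // eq_sym mn mul0r mulr0.
Qed.

(** Both sides have dimension |N|^2. The image of a kernel element y, evaluated on K, is a relation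
    between the n^-1; by [complement_independent] its coefficients vanish, and they determine y. *)
Lemma complement_galois_map_bij : bijective (galois_map mu).
Proof.
apply: (@lfun_bij _ _ _ (tlift (fun s h => (amull s \o mu h)%VF))) => [|y y0].
  change (dim (subvs_of K) * dim H = dim (subvs_of K) * dim (subvs_of K))%N.
  rewrite (dim_gp_algebra galL formH) defP card_in_imset //.
  by rewrite -dim_complement.
have tform0 : forall n, n \in N -> tform vsval (ev (lam n)) y = 0.
  pose c n := tform vsval (ev (lam n)) y.
  apply: (complement_independent (c := c)) => z Kz.
  pose z' := vsproj K z; have Dz : vsval z' = z by rewrite vsprojK.
  pose val_z (f : 'End(subvs_of K)) := vsval (f z').
  have val_z_lin : linear val_z.
    by move=> a f g; rewrite /val_z add_lfunE scale_lfunE linearP.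
  pose Fz : {linear 'End(subvs_of K) -> L} :=
    HB.pack val_z (GRing.isLinear.Build _ _ _ _ _ val_z_lin).
  have := congr1 Fz y0; rewrite linear0 linear_tlift => tz0.
  rewrite -[RHS]tz0.
  under eq_bigr => n _ do rewrite mulrC -tlift_mulrl.
  rewrite -tlift_sum; apply: eq_tlift => s h.
  rewrite /= /val_z comp_lfunE lfunE /= muE Dz mulr_sumr.
  by apply: eq_bigr => m _; rewrite mulrCA [ev _ _ * _]mulrC.
apply: (@tform_eq0r _ L unit gT _ _ (fun=> vsval) ev _ (ev_free galL formH)).
  by move=> v /(_ tt) v0; apply: val_inj; rewrite linear0.
move=> _ t; have [|Pt] := boolP (t \in P).
  by rewrite defP => /imsetP[n Nn ->]; apply: tform0.
rewrite tform_basis big1 // => a _; rewrite big1 // => b _.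
by rewrite (ev_out formH) ?mulr0.
Qed.

Lemma complement_hopf_galois : hopf_galois_structure A mu.
Proof.
split; [|exact: complement_hopf_action|exact: complement_galois_map_bij].
exact: (grouplike_hopf_cocommutative galL formH hopfA).
Qed.

End ComplementAction.

(** * Coefficients of elements of L[P]^G *)

Section GroupAlgebraForm.
Variables (k : fieldType) (L : splittingFieldType k) (K : {subfield L}).
Local Notation G := ('Gal({:L} / 1))%G.
Local Notation G' := ('Gal({:L} / K))%G.
Local Notation T := (gcoset K).

Lemma gal_sub_ltrans_dom : G \subset subact_dom [in rcosets G' G] 'Rs.
Proof.
apply/subsetP => x Gx; rewrite /subact_dom /astabs !inE /=.
apply/subsetP=> D; rewrite !inE => /rcosetsP[y Gy ->] /=.
by apply/rcosetsP; exists (y * x)%g; rewrite ?groupM //= rcosetE rcosetM.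
Qed.

Lemma ltransM : {in G &, {morph ltrans K : x y / (x * y)%g}}.
Proof. by move=> x y Gx Gy; rewrite morphM ?(subsetP gal_sub_ltrans_dom). Qed.

Lemma ltransV : {in G, {morph ltrans K : x / x^-1%g}}.
Proof. by move=> x Gx; rewrite morphV ?(subsetP gal_sub_ltrans_dom). Qed.

Lemma ltransJ : {in G &, {morph ltrans K : x y / (x ^ y)%g}}.
Proof.
by move=> x y Gx Gy; rewrite /conjg !ltransM ?ltransV ?groupM ?groupV.
Qed.

Variable P : {group {perm T}}.
Local Notation H := (subvs_of (gp_algebra P)).

Definition pev (s : {perm T}) (h : H) : L := pcoef (vsval h) s.

Fact pev_is_linear s :
  linear (pev s : (H : vectType k) -> (L : fieldExtType k)).
Proof. by move=> a x y; rewrite /pev linearP paddE pscaleE. Qed.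

HB.instance Definition _ s :=
  GRing.isLinear.Build k (H : vectType k) (L : fieldExtType k) *:%R (pev s)
    (pev_is_linear s).

Lemma pev_out h s : s \notin P -> pev s h = 0.
Proof. by have /gp_spaceP[outh _] := subvsP h; apply: outh. Qed.

Lemma pev_gal h x s : x \in G -> x (pev s h) = pev (s ^ ltrans K x) h.
Proof.
move=> Gx; have /gp_spaceP[_ fixh] := subvsP h.
by rewrite /pev -[in RHS](fixh x Gx) /gp_act [in RHS]/pcoef ffunE conjgK.
Qed.

Lemma eq_pev h h' : (forall s, pev s h = pev s h') -> h = h'.
Proof. by move=> hh'; apply/val_inj/permalgP. Qed.

Definition pmk (f : {perm T} -> L) : H :=
  vsproj (gp_algebra P) ([ffun s => f s] : permalg L T).

Lemma pev_pmk f :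
    (forall s, s \notin P -> f s = 0) ->
    (forall x s, x \in G -> x (f s) = f (s ^ ltrans K x)%g) ->
  forall s, pev s (pmk f) = f s.
Proof.
move=> outf galf s; rewrite /pev vsprojK ?[LHS]ffunE //.
apply/gp_spaceP; split=> [t Pt | x Gx]; first by rewrite /pcoef ffunE outf.
by apply/permalgP=> t; rewrite /pcoef !ffunE /pcoef ffunE galf // conjgKV.
Qed.

Lemma pev1 s : pev s 1 = (s == 1%g)%:R.
Proof.
suffices: algid (gp_algebra P) == 1 by rewrite /pev /= => /eqP->; apply: poneE.
rewrite algid_eq1; apply/gp_spaceP; split=> [t | x Gx].
  by rewrite poneE; case: eqP => // ->; rewrite group1.
apply/permalgP=> t; rewrite [LHS]ffunE !poneE conjg_eq1.
by case: eqP; rewrite ?rmorph1 ?rmorph0.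
Qed.

Lemma pevM s h h' : pev s (h * h') = \sum_t pev t h * pev (s * t^-1)%g h'.
Proof. exact: pmulE. Qed.

Lemma gp_galois_form :
    {in P & G, forall s x, (s ^ ltrans K x)%g \in P} ->
  @galois_form k L H _ P (ltrans K)
    (fun s => pev s : {linear (H : vectType k) -> (L : fieldExtType k)}).
Proof.
move=> nPG; split=> //.
- exact: ltransM.
- exact: eq_pev.
- exact: pev_out.
- exact: pev_gal.
- by move=> f outf galf; exists (pmk f); apply: pev_pmk.
- exact: pev1.
- exact: pevM.
Qed.

End GroupAlgebraForm.

(** * The normal complement inside Perm(G/G') *)

Section NormalComplement.
Variables (k : fieldType) (L : splittingFieldType k) (K : {subfield L}).
Variable N : {group gal_of {:L}}.
Local Notation G := ('Gal({:L} / 1))%G.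
Local Notation G' := ('Gal({:L} / K))%G.
Hypothesis complN : normal_complement N G' G.

Lemma ltrans_gcoset1 x : x \in G -> val (ltrans K x (gcoset1 K)) = (G' :* x)%g.
Proof. exact: ltransE. Qed.

(** Equal images of the base coset put x y^-1 in both N and G'. *)
Lemma ltrans_complement_inj : {in N &, injective (ltrans K)}.
Proof.
have [/normal_sub/subsetP sNG TI _] := complN.
move=> x y Nx Ny exy; apply/eqP; rewrite eq_mulgV1 -in_set1 -set1gE -TI.
rewrite inE groupM ?groupV //= -mem_rcoset -ltrans_gcoset1 ?sNG // -exy.
by rewrite ltrans_gcoset1 ?sNG // rcoset_refl.
Qed.

Lemma ltrans_complement : (ltrans K @* N)%g = [set ltrans K x | x in N].
Proof.
have [/normal_sub sNG _ _] := complN.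
by rewrite morphimEsub // (subset_trans sNG) // gal_sub_ltrans_dom.
Qed.

Lemma ltrans_complement_stable :
  {in (ltrans K @* N)%g & G,
    forall s x, (s ^ ltrans K x)%g \in (ltrans K @* N)%g}.
Proof.
have [/andP[/subsetP sNG /subsetP nNG] _ _] := complN.
move=> s x; rewrite ltrans_complement => /imsetP[n Nn ->] Gx.
by rewrite -ltransJ ?imset_f ?memJ_norm ?nNG // sNG.
Qed.

(** A representative of the coset of n^-1 differs from n^-1 by an element of G', which fixes K. *)
Lemma repr_ltrans_complement (n : gal_of {:L}) y : n \in N -> y \in K ->
  (repr (val ((ltrans K n)^-1%g (gcoset1 K))) : gal_of {:L}) y = n^-1%g y.
Proof.
have [/normal_sub/subsetP sNG _ _] := complN.
move=> Nn Ky; rewrite -ltransV ?sNG // ltrans_gcoset1 ?groupV ?sNG //.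
have /rcosetP[g G'g ->] := mem_repr_rcoset G' n^-1%g.
by rewrite galM ?memvf // (fixed_gal (subvf K) G'g Ky).
Qed.

(** The preimage of Q in N is stable under conjugation by G', which induces every automorphism of N;
    it is thus characteristic. *)
Lemma stable_sub_complement (Q : {group {perm gcoset K}}) :
    charsimple N ->
    Aut N \subset [set conj_aut N x | x in G'] ->
    Q \subset (ltrans K @* N)%g ->
    {in Q & G, forall s x, (s ^ ltrans K x)%g \in Q} ->
  Q :=: 1%g \/ Q :=: (ltrans K @* N)%g.
Proof.
move=> /charsimpleP[_ simN] sAutG' sQN nQG.
have [/andP[sNG nNG] _ _] := complN.
have sNdom := subset_trans sNG (gal_sub_ltrans_dom K).
pose M := (N :&: ltrans K @*^-1 Q)%G.
have memM x : x \in N -> (x \in M) = (ltrans K x \in Q).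
  by move=> Nx; have := subsetP sNdom x Nx; rewrite !inE Nx => ->.
have defQ : Q :=: (ltrans K @* M)%g.
  apply/setP=> t; apply/idP/morphimP => [Qt | [x Dx Mx ->]]; last first.
    by rewrite -memM //; case/setIP: Mx.
  have /morphimP[x Dx Nx Dt] := subsetP sQN t Qt.
  by exists x; rewrite ?memM // -Dt.
have [M1 | ntM] := eqVneq (gval M) 1%g; first by left; rewrite defQ M1 morphim1.
right; rewrite defQ; congr (_ @* _)%g; apply: simN => //.
apply/andP; split; first exact: subsetIl.
apply/forall_inP => f /(subsetP sAutG')/imsetP[x G'x ->].
have Gx := subsetP (galS {:L} (sub1v K)) x G'x.
apply/subsetP=> _ /imsetP[y My ->]; have [Ny _] := setIP My.
rewrite norm_conj_autE ?(subsetP nNG) //.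
have Gy := subsetP sNG y Ny.
rewrite memM ?memJ_norm ?(subsetP nNG) // ltransJ // nQG //.
by rewrite -memM.
Qed.

End NormalComplement.

Theorem lemma1 (k : fieldType) (L : splittingFieldType k) (K : {subfield L})
    (sepK : separable 1 K) (closK : is_normal_closure K)
    (N : {group gal_of {:L}})
    (charN : charsimple N)
    (complN : normal_complement N 'Gal({:L} / K) 'Gal({:L} / 1))
    (phi_inj : {in 'Gal({:L} / K)%g &, injective (conj_aut N)})
    (phi_surj : [set conj_aut N x | x in 'Gal({:L} / K)%g] = Aut N) :
  exists (A : hopf_algebra (subvs_of (gp_algebra (ltrans K @* N)%G)))
         (mu : 'Hom(subvs_of (gp_algebra (ltrans K @* N)%G), 'End(subvs_of K))),
    [/\ gp_structure A mu, hopf_galois_structure A mu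
      & minimal_hopf_algebra A].
Proof.
have galL := normal_closure_galois sepK closK.
have formH := gp_galois_form (ltrans_complement_stable complN).
have lam_inj := ltrans_complement_inj complN.
have defP := ltrans_complement complN.
have [A hopfA] := grouplike_hopf_exists galL formH.
have [mu muE] := complement_action_exists galL complN formH.
exists A, mu; split.
- split=> [h s t | h | h t | h y].
  + have := ev_comul hopfA h s t; rewrite /tform /= => ->.
    by case: eqP => _; rewrite ?mul1r ?mul0r.
  + exact: ev_counit hopfA h.
  + exact: ev_antipode hopfA h t.
  (* Coefficients vanish off the image of N, so the sum over all permutations reduces to one over
     N. *)
  + rewrite muE; have := sum_ev formH lam_inj defP h.
    move/(_ (fun t =>
      (repr (val (t^-1%g (gcoset1 K))) : gal_of {:L}) (vsval y))).
    move=> ->; apply: eq_bigr => n Nn.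
    by rewrite /= (repr_ltrans_complement complN Nn (subvsP y)).
- exact: (complement_hopf_galois galL complN formH lam_inj defP hopfA muE).
apply: (minimal_hopf_of_stable galL formH hopfA) => [|Q sQP stabQ].
  have [ntN _] := charsimpleP _ charN.
  by rewrite -cardG_gt1 /= defP card_in_imset // cardG_gt1.
apply: (stable_sub_complement complN charN _ sQP stabQ).
by rewrite phi_surj.
Qed.
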